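(* Assume A1--A5 (listed in the context). Let $\gamma\in[0,1)$ satisfy $0\le\gamma\le\min\{\gamma_t : t\in\{0,\ldots,k-1\}\}$, where $$\gamma_{k-1}=\frac{m_{k-1}}{(Lc_{\max}+P)\,\eta_k},\qquad \gamma_t=\frac{m_t}{(Lc_{\max}+P)(\eta_{t+1}+c+\kappa_{t+1})+m_{t+1}}\quad (t=0,\ldots,k-2).$$ Then there exist a constant $\varphi\in[0,c_{\max}]$ and, for each $t\in\{0,\ldots,k-1\}$, thresholds $s_t,S_t,\sigma_t,\Sigma_t$ such that the following hold. (i) An optimal policy $(r_t^*(x),u_t^*(x))$ is given, for $t\in\{0,\ldots,k-1\}$ and $x\in[0,c_{\max}]$, by: if $x\in[0,\sigma_t)$, then $r_t^*=1$ and $u_t^*=\varphi$; if $x\in[\sigma_t,s_t)$, then $r_t^*=0$ and $u_t^*=S_t-x$; if $x\in[s_t,\Sigma_t)$, then $r_t^*=0$ and $u_t^*=0$; if $x\ge\Sigma_t$, then $r_t^*=1$ and $u_t^*=\varphi$. (ii) For $t\in\{0,\ldots,k-1\}$ and $x\in[0,c_{\max}]$, the value function has the form $$J(x,t)=\begin{cases} J_0+\mathbb{E}(s(x,t,w)), & x\in[0,\sigma_t),\\ c(S_t-x)+K+H(S_t,t)+\gamma\,\mathbb{E}(J((S_t-w)^+,t+1)), & x\in[\sigma_t,s_t),\\ H(x,t)+\gamma\,\mathbb{E}(J((x-w)^+,t+1)), & x\in[s_t,\Sigma_t),\\ J_0+\mathbb{E}(s(x,t,w)), & x\ge\Sigma_t,\end{cases}$$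 and each piece has a Lipschitz derivative which is absolutely bounded by $M_t=\eta_t+c+\kappa_t+m_t/(Lc_{\max}+P)$.
   Context: Notation: $(x)^+=\max\{x,0\}$; $\mathbf{1}_{\mathbb{R}^*_+}(u)=1$ if $u>0$ and $0$ otherwise; $\mathbb{B}=\{0,1\}$; $k\ge1$ is a fixed integer. A quotient of a positive number by $0$ is read as $+\infty$. Reset control problem. States $(x_n,t_n)$ with $t_n\in\mathbb{Z}_+$, controls $(u_n,r_n)$ with $r_n\in\mathbb{B}$ chosen non-anticipatively (before $w_n$ is observed), i.i.d. disturbances $w_n$ ($w$ denotes a generic copy), known reset state $\zeta$. The dynamics are $\xi_n=x_n(1-r_n)+\zeta r_n$, $\tau_n=t_n(1-r_n)$, $x_{n+1}=h(\xi_n,\tau_n,u_n,w_n)$, $t_{n+1}=\tau_n+1$. The problem is to minimize $\mathbb{E}\big[\sum_{n=0}^\infty\gamma^n\big(g(\xi_n,\tau_n,u_n,w_n)+s(x_n,t_n,w_n)r_n\big)\big]$ subject to the dynamics, $t_n\le k$ (so $r_n=1$ is forced when $t_n=k$) and $u_n\in\mathcal{U}_n$ for all $n\ge0$, where $g\ge0$ is a continuous stage cost and $s\ge0$ is a continuous reset cost with $s(\zeta,t,w)\equiv0$. $J(x,t)$ is the optimal value with initial condition $x_0=x$, $t_0=t$, and $J_0=J(\zeta,0)$. It satisfies the (known) dynamic programming equations $J_0=\min_{u\in\mathcal{U}_0}\mathbb{E}[g(\zeta,0,u,w)+\gamma J(h(\zeta,0,u,w),1)]$; $J(x,t)=\min\{J_0+\mathbb{E}(s(x,t,w)),\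 \min_{u\in\mathcal{U}_t}\mathbb{E}[g(x,t,u,w)+\gamma J(h(x,t,u,w),t+1)]\}$ for $t=0,\ldots,k-1$; $J(x,k)=J_0+\mathbb{E}(s(x,k,w))$. Here $\mathcal{U}_t$ is the set of admissible $u$ when the (pseudo-)state is $(x,t)$, and $\mathcal{U}_0$ in the first equation is the set for $(\zeta,0)$. A policy is a map $(x,t)\mapsto(r,u)$, where $u$ is the order placed after the reset decision. A1. $x_n\in\mathbb{R}_+$ and $h(\xi,\tau,u,w)=(\xi+u-w)^+$. A2. $\mathbb{E}(g(\xi,\tau,u,w))=cu+K\,\mathbf{1}_{\mathbb{R}^*_+}(u)+H(\xi+u,\tau)$, where for admissible $x,u$ (so $x+u\in[0,c_{\max}]$) $|\partial_xH(x+u,t)|\le\kappa_t$ and $\partial_{xx}H(x+u,t)\ge m_t$ (derivatives in the first argument), with constants $c,K,\kappa_t\ge0$ and $m_t>0$ for $t=0,\ldots,k-1$. A3. $\zeta=0$. $R(x,t):=\mathbb{E}(s(x,t,w))$ is concave and non-decreasing in $x$, $|\partial_xR(x,t)|\le\eta_t$, and $|\partial_xR(x,t)-\partial_xR(x',t)|\le L_t|x-x'|$, with constants $\eta_t,L_t\ge0$, for $t=0,\ldots,k$. A4. $\mathcal{U}_n=\{u:0\le u\le c_{\max}-\xi_n\}$, with a constant $c_{\max}\ge0$. A5. The $w_n$ are i.i.d. with density $f$ satisfying $f(w)=0$ for $w<0$, $f$ Lipschitz on $w\ge0$ with constant $L\ge0$, and $|f(w)|\le P$ for $w\ge0$ with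 constant $P\ge0$. Threshold conventions: $S_t\in[0,c_{\max}]$ and $0\le\sigma_t\le s_t\le\Sigma_t\le+\infty$; some of the four regions may be empty.
   Formalization: In A2 the second derivative of H(.,t) is also assumed bounded above on [0,c_max] (automatic if H(.,t) is C^2); without this the no-order piece J = H + ... need not have a Lipschitz derivative, e.g. for gamma=0 with an unbounded second derivative of H. *)

(* Defs.v *)
From HB Require Import structures.
From mathcomp Require Import all_boot all_order all_algebra.
From mathcomp Require Import all_classical all_reals all_analysis.

Set Implicit Arguments.
Unset Strict Implicit.
Unset Printing Implicit Defensive.

Import Order.TTheory GRing.Theory Num.Theory.
Import numFieldNormedType.Exports.

Local Open Scope classical_set_scope.
Local Open Scope ring_scope.

(* Data of a reset control problem.  In [dynamics], [stage_cost] and [orders]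
   the first two arguments are the state (xi, tau) after the reset decision;
   in [reset_cost] they are the state (x, t) before it. *)
Record problem (R : realType) := Problem {
  period : nat;
  discount : R;
  dynamics : R -> nat -> R -> R -> R;
  stage_cost : R -> nat -> R -> R -> R;
  reset_cost : R -> nat -> R -> R;
  reset_state : R;
  orders : R -> nat -> set R
}.

Section Derivative.
Context {R : realType}.
Implicit Types (I : set R) (F : R -> R).

(* Derivative of F at x relative to I: two-sided at interior points of I,
   one-sided at end points; no condition if x is isolated in I. *)
Definition derive_in I F (x d : R) : Prop :=
  (F y - F x) / (y - x) @[y --> within I x^'] --> d.

Definition smooth_piece I (M : R) F : Prop :=
  exists D : R -> R,
    [/\ forall x, I x -> derive_in I F x (D x),
        forall x, I x -> `|D x| <= M
      & [lipschitz D x | x in I]].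

(* [0, cmax] `&` [a, b), with extended real end points. *)
Definition piece (cmax : R) (a b : \bar R) : set R :=
  [set x | 0 <= x <= cmax /\ (a <= x%:E < b)%E].

End Derivative.

Section ControlProblem.
Context {R : realType} {d : measure_display} {T : measurableType d}
  {P : probability T R}.
Implicit Types (pb : problem R) (w : nat -> {RV P >-> R}).

Definition independent_seq w : Prop :=
  forall (n : nat) (B : nat -> set R), (forall i, measurable (B i)) ->
    P (\bigcap_(i in `I_n) (w i @^-1` B i)) =
    (\prod_(i < n) P (w i @^-1` B i))%E.

(* Expectation of F(w), w a generic copy of the disturbances. *)
Definition expect w (F : R -> \bar R) : \bar R :=
  (\int[P]_om F (w 0%N om))%E.

(* A pair (r, u) is a reset decision together with the order placed after it.
   A state (x, t) is a pair of type R * nat. *)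

Definition after_reset pb (z : R * nat) (r : bool) : R * nat :=
  if r then (reset_state pb, 0%N) else z.

Definition step pb (z : R * nat) (a : bool * R) (v : R) : R * nat :=
  let p := after_reset pb z a.1 in (dynamics pb p.1 p.2 a.2 v, p.2.+1).

Definition step_cost pb (z : R * nat) (a : bool * R) (v : R) : R :=
  let p := after_reset pb z a.1 in
  stage_cost pb p.1 p.2 a.2 v + reset_cost pb z.1 z.2 v * (a.1)%:R.

Definition controls := nat -> T -> bool * R.

Fixpoint state pb w (z : R * nat) (a : controls) (n : nat) (om : T) : R * nat :=
  if n is n'.+1 then step pb (state pb w z a n' om) (a n' om) (w n' om) else z.

(* The sigma-algebra generated by w_0, ..., w_{n-1}. *)
Definition past w (n : nat) : set (set T) :=
  <<s \bigcup_(i in `I_n) preimage_set_system setT (w i) measurable >>.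

Definition nonanticipative w (a : controls) : Prop :=
  forall n, past w n [set om | (a n om).1] /\
    forall B : set R, measurable B -> past w n [set om | B (a n om).2].

Definition admissible pb w (z : R * nat) (a : controls) : Prop :=
  nonanticipative w a /\
  forall n, {ae P, forall om,
    let y := state pb w z a n om in
    let p := after_reset pb y (a n om).1 in
    (y.2 <= period pb)%N /\ orders pb p.1 p.2 (a n om).2}.

Definition total_cost pb w (z : R * nat) (a : controls) : \bar R :=
  (\int[P]_om \sum_(0 <= n <oo)
     (discount pb ^+ n *
        step_cost pb (state pb w z a n om) (a n om) (w n om))%:E)%E.

Definition value pb w (x : R) (t : nat) : \bar R :=
  ereal_inf [set total_cost pb w (x, t) a | a in admissible pb w (x, t)].

Definition policy := R -> nat -> bool * R.

Fixpoint closed_loop_state pb w (pi : policy) (z : R * nat) (n : nat) (om : T) :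
    R * nat :=
  if n is n'.+1 then
    let y := closed_loop_state pb w pi z n' om in
    step pb y (pi y.1 y.2) (w n' om)
  else z.

Definition closed_loop pb w (pi : policy) (z : R * nat) : controls :=
  fun n om => let y := closed_loop_state pb w pi z n om in pi y.1 y.2.

(* pi is optimal from every initial state (x, t) with x in X, t <= k. *)
Definition optimal_policy pb w (X : set R) (pi : policy) : Prop :=
  forall x t, X x -> (t <= period pb)%N ->
    let a := closed_loop pb w pi (x, t) in
    admissible pb w (x, t) a /\ total_cost pb w (x, t) a = value pb w x t.

(* R(x, t) = E(s(x, t, w)), as a real number. *)
Definition mean_reset_cost pb w (x : R) (t : nat) : R :=
  fine (expect w (fun v => (reset_cost pb x t v)%:E)).

(* The stage cost is allowed to jump at u = 0, to accommodate the fixed cost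
   K 1_{u > 0} in its mean; a jointly continuous stage cost qualifies.
   Negative x, xi and u are never used: costs given on the nonnegative values
   extend by precomposition with the positive part. *)
Definition standing_assumptions pb : Prop :=
  [/\ (1 <= period pb)%N,
      forall xi tau u v, 0 <= stage_cost pb xi tau u v,
      forall tau,
        (forall p : R * R * R, p.1.2 != 0 ->
           {for p, continuous
             (fun q : R * R * R => stage_cost pb q.1.1 tau q.1.2 q.2)}) /\
        continuous (fun q : R * R => stage_cost pb q.1 tau 0 q.2),
      forall x t v, 0 <= reset_cost pb x t v
    & forall t,
        continuous (fun q : R * R => reset_cost pb q.1 t q.2) /\
        forall v, reset_cost pb (reset_state pb) t v = 0].

Definition A1 pb : Prop :=
  forall xi tau u v, dynamics pb xi tau u v = Num.max (xi + u - v) 0.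

(* The upper bound B on the second derivative is automatic when H(., t) is C^2
   on [0, cmax]; without it dH(., t) need not be Lipschitz. *)
Definition A2 pb w (cmax c K : R) (H : R -> nat -> R) (kappa m : nat -> R) :
    Prop :=
  [/\ 0 <= c /\ 0 <= K,
      forall t, (t < period pb)%N -> 0 <= kappa t /\ 0 < m t,
      forall (xi : R) tau (u : R), (tau < period pb)%N -> 0 <= xi -> 0 <= u <= cmax - xi ->
        expect w (fun v => (stage_cost pb xi tau u v)%:E) =
        (c * u + K * (0 < u)%R%:R + H (xi + u) tau)%:E
    & exists dH ddH : R -> nat -> R, forall t, (t < period pb)%N ->
        (forall y, 0 <= y <= cmax ->
           [/\ derive_in `[0, cmax] (H ^~ t) y (dH y t),
               derive_in `[0, cmax] (dH ^~ t) y (ddH y t),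
               `|dH y t| <= kappa t & m t <= ddH y t]) /\
        exists B : R, forall y, 0 <= y <= cmax -> ddH y t <= B].

Definition A3 pb w (eta Lr : nat -> R) : Prop :=
  reset_state pb = 0 /\
  forall t, (t <= period pb)%N ->
    let Rt := mean_reset_cost pb w ^~ t in
    [/\ 0 <= eta t /\ 0 <= Lr t,
        forall x, 0 <= x ->
          expect w (fun v => (reset_cost pb x t v)%:E) \is a fin_num,
        forall x y a, 0 <= x -> 0 <= y -> 0 <= a <= 1 ->
          a * Rt x + (1 - a) * Rt y <= Rt (a * x + (1 - a) * y),
        forall x y, 0 <= x -> x <= y -> Rt x <= Rt y
      & exists dR : R -> R,
          (forall x, 0 <= x ->
             derive_in `[0, +oo[ Rt x (dR x) /\ `|dR x| <= eta t) /\
          (Lr t).-lipschitz_`[0, +oo[ dR].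

Definition A4 pb (cmax : R) : Prop :=
  0 <= cmax /\ forall xi tau, orders pb xi tau = [set u | 0 <= u <= cmax - xi].

Definition A5 w (f : R -> R) (L Pf : R) : Prop :=
  [/\ independent_seq w,
      (forall y, 0 <= f y) /\
      forall n (B : set R), measurable B ->
        distribution P (w n) B = (\int[lebesgue_measure]_(y in B) (f y)%:E)%E,
      forall y, y < 0 -> f y = 0,
      0 <= L /\ L.-lipschitz_`[0, +oo[ f
    & 0 <= Pf /\ forall y, 0 <= y -> `|f y| <= Pf].

End ControlProblem.

Section Constants.
Context {R : realType}.
Variables (k : nat) (cmax c L Pf : R) (kappa m eta : nat -> R).

(* In \bar R, 0^-1 = +oo. *)
Definition discount_bound (t : nat) : \bar R :=
  if t.+1 == k then
    ((m t)%:E / ((L * cmax + Pf) * eta k)%:E)%E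
  else
    ((m t)%:E /
      ((L * cmax + Pf) * (eta t.+1 + c + kappa t.+1) + m t.+1)%:E)%E.

Definition slope_bound (t : nat) : R :=
  eta t + c + kappa t + m t / (L * cmax + Pf).

End Constants.

(* Main.v *)
Require Import Defs.
From HB Require Import structures.
From mathcomp Require Import all_boot all_order all_algebra.
From mathcomp Require Import all_classical all_reals all_analysis.
From mathcomp Require Import measurable_realfun.
From mathcomp Require Import ring lra.

Set Implicit Arguments.
Unset Strict Implicit.
Unset Printing Implicit Defensive.

Import Order.TTheory GRing.Theory Num.Theory.
Import numFieldNormedType.Exports.

Local Open Scope classical_set_scope.
Local Open Scope ring_scope.

(** The problem is solved backwards from the forced reset.  Let [j] be the value
    just after a reset.  With [t] on the clock and stock [x], the controller
    either resets, at cost [j + r x t], or orders up to some level [y], at cost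
    [c (y - x) + K 1_(y > x) + Phi_t y], where
    [Phi_t y = H y t + discount * E (V_(t+1) (y - w))] and [V_(t+1)] is the value
    function of the next stage.  If [Phi_t] is convex, then so is [c y + Phi_t y]
    and the order-up-to rule with levels [s] and [S] is optimal among the orders
    (sS_optimal).  The points where continuing is no worse than resetting then
    form an interval, because the cost of resetting is concave and nondecreasing
    while the cost of continuing is first decreasing and then convex
    (reset_thresholds).  This yields the four regions.

    The convexity of [Phi_t] is where the bound on the discount enters.  The
    function [V_(t+1)] is a minimum and need not be convex, but it is Lipschitz
    with constant [M_(t+1)], and taking the expectation against a Lipschitz
    density gains one derivative: increments of [E (V_(t+1) (y - w))] over
    intervals of equal length [h] whose distance is [d] differ by at most
    [(L cmax + Pf) M_(t+1) h d] (mean_increment), so that this function has a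
    Lipschitz derivative (increment_lipschitz_derive).  After discounting, the
    constant is at most [m t], and the strong convexity of [H] prevails
    (continuation_smooth).  The same estimates give the slope [M_t] of [V_t] and
    close the backward induction (value_to_go_regular).  The value [j] is a fixed
    point of the monotone map that computes the value after a reset from itself
    (reset_value_exists).

    It remains to see that the solution of these equations is the value function
    of the control problem (verification).  A nonanticipative control and the
    state it produces are functions of the past, which is independent of the
    next disturbance (past_independent); hence each step may be averaged over
    the disturbance with state and control held fixed (freezing).  The expected
    discounted cost up to time [n], plus the discounted expectation of [V] at
    time [n], is then at least [V] at the initial state, with equality for the
    threshold policy, and the last term vanishes as [n] grows. *)

(** * Derivatives relative to an interval *)

Section Calculus.
Context {R : realType}.
Implicit Types (I : set R) (F D : R -> R).

(** Clearing the denominator makes the condition at [y = x] trivial, so that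
    the punctured neighbourhoods disappear from the estimates below. *)
Lemma derive_inP I F x d :
  derive_in I F x d <->
  forall e, 0 < e -> exists2 r, 0 < r &
    forall y, I y -> `|y - x| < r ->
      `|F y - F x - d * (y - x)| <= e * `|y - x|.
Proof.
rewrite /derive_in; split.
  move=> /cvgrPdist_le + e e0 => /(_ e e0).
  rewrite /prop_near1 /within/= => -[r /= r0 H].
  exists r => // y Iy yxr.
  have [->|yx] := eqVneq y x; first by rewrite !subrr mulr0 subrr normr0 mulr0.
  have := H y; rewrite /ball/= distrC => /(_ yxr yx Iy).
  have yx0 : y - x != 0 by rewrite subr_eq0.
  have -> : F y - F x - d * (y - x) = - (d - (F y - F x) / (y - x)) * (y - x).
    by field.
  by rewrite normrM normrN; apply: ler_wpM2r.
move=> H; apply/cvgrPdist_le => e e0.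
have [r r0 {}H] := H e e0.
rewrite /prop_near1 /within/=; exists r => //= y; rewrite /ball/= distrC.
move=> yxr yx Iy; have := H y Iy yxr.
have yx0 : y - x != 0 by rewrite subr_eq0.
have -> : F y - F x - d * (y - x) = - (d - (F y - F x) / (y - x)) * (y - x).
  by field.
by rewrite normrM normrN ler_pM2r// normr_gt0.
Qed.

Lemma derive_in_sub I I' F F' x d : I' `<=` I -> I' x ->
  (forall y, I' y -> F' y = F y) -> derive_in I F x d -> derive_in I' F' x d.
Proof.
move=> sub I'x FF' /derive_inP H; apply/derive_inP => e /H[r r0 {}H].
by exists r => // y I'y yxr; rewrite !FF'//; apply: H => //; apply: sub.
Qed.

Lemma derive_inD I F G x d d' : derive_in I F x d -> derive_in I G x d' ->
  derive_in I (fun y => F y + G y) x (d + d').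
Proof.
move=> /derive_inP H /derive_inP H'; apply/derive_inP => e e0.
have e20 : 0 < e / 2 by rewrite divr_gt0.
have [r r0 {}H] := H _ e20; have [r' r'0 {}H'] := H' _ e20.
exists (Num.min r r'); first by rewrite lt_min r0.
move=> y Iy; rewrite lt_min => /andP[/(H _ Iy) h /(H' _ Iy) h'].
have -> : F y + G y - (F x + G x) - (d + d') * (y - x) =
  (F y - F x - d * (y - x)) + (G y - G x - d' * (y - x)) by ring.
rewrite (le_trans (ler_normD _ _))// (le_trans (lerD h h'))//.
by rewrite -mulrDl -splitr.
Qed.

Lemma derive_inZ I F x d a : derive_in I F x d ->
  derive_in I (fun y => a * F y) x (a * d).
Proof.
move=> /derive_inP H; apply/derive_inP => e e0.
have a1 : 0 < `|a| + 1 by rewrite ltr_wpDl.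
have [r r0 {}H] := H _ (divr_gt0 e0 a1).
exists r => // y Iy /(H _ Iy) h.
have -> : a * F y - a * F x - a * d * (y - x) = a * (F y - F x - d * (y - x)).
  by ring.
rewrite normrM; apply: le_trans (ler_wpM2l _ h) _ => //.
rewrite mulrA ler_wpM2r// mulrCA ler_piMr ?(ltW e0)//.
by rewrite ler_pdivrMr// mul1r lerDl.
Qed.

Lemma derive_in_affine I x a b : derive_in I (fun y => a * y + b) x a.
Proof.
apply/derive_inP => e e0; exists 1 => // y Iy _.
have -> : a * y + b - (a * x + b) - a * (y - x) = 0 by ring.
by rewrite normr0 mulr_ge0// ltW.
Qed.

Lemma derive_in_is_derive I F x d r : 0 < r ->
  (forall y, `|y - x| < r -> I y) -> derive_in I F x d -> is_derive x 1 F d.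
Proof.
move=> r0 Ir /derive_inP H.
have cv : (h^-1 *: (F (h *: 1 + x) - F x)) @[h --> 0^'] --> d.
  apply/cvgrPdist_le => e e0.
  have [s s0 {}H] := H e e0.
  exists (Num.min r s); first by rewrite /= lt_min r0.
  move=> h; rewrite /ball_/= sub0r normrN lt_min => /andP[hr hs] h0.
  have e1 : h *: 1 + x - x = h by rewrite addrK /GRing.scale/= mulr1.
  have := H (h *: 1 + x); rewrite e1 => /(_ (Ir _ _) hs).
  rewrite e1 => /(_ hr).
  have -> : F (h *: 1 + x) - F x - d * h =
    - (d - h^-1 *: (F (h *: 1 + x) - F x)) * h.
    by rewrite /GRing.scale/=; field.
  by rewrite normrM normrN ler_pM2r// normr_gt0.
split; first by apply/cvg_ex; exists d.
exact/cvg_lim.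
Qed.

Lemma derive_in_continuous I F D :
  (forall x, I x -> derive_in I F x (D x)) -> {within I, continuous F}.
Proof.
move=> H; apply: continuous_subspaceW; first exact: subset_refl.
apply/subspace_continuousP => x Ix.
have /derive_inP/(_ 1 ltr01)[r r0 {}H] := H x Ix.
apply/cvgrPdist_le => e e0; rewrite /prop_near1 /within/=.
have D1 : 0 < `|D x| + 1 by rewrite ltr_wpDl.
exists (Num.min r (e / (`|D x| + 1))); first by rewrite /= lt_min r0 divr_gt0.
move=> y; rewrite /ball/= lt_min distrC => /andP[/H {}H].
rewrite ltr_pdivlMr// => ye Iy; rewrite distrC.
have -> : F y - F x = (F y - F x - D x * (y - x)) + D x * (y - x) by ring.
rewrite (le_trans (ler_normD _ _))// normrM.
have := H Iy; nra.
Qed.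

(** Inside [[a, b]] a derivative relative to [[a, b]] is a derivative, so the
    mean value theorem applies. *)
Lemma increment_bounds (a b l u : R) F D : a <= b ->
  (forall x, a <= x <= b -> derive_in `[a, b] F x (D x)) ->
  (forall x, a < x < b -> l <= D x <= u) ->
  l * (b - a) <= F b - F a <= u * (b - a).
Proof.
rewrite le_eqVlt => /predU1P[->|ab] dF lu.
  by rewrite !subrr !mulr0 lexx.
have cF : {within `[a, b], continuous F}.
  by apply: (@derive_in_continuous _ _ D) => x /=; rewrite in_itv/=; exact: dF.
have isd x : x \in `]a, b[ -> is_derive x 1 F (D x).
  rewrite in_itv/= => /andP[ax xb].
  apply: (@derive_in_is_derive `[a, b] _ _ _ (Num.min (x - a) (b - x))).
  - by rewrite lt_min !subr_gt0 ax.
  - move=> y; rewrite lt_min !ltr_norml/= in_itv/=; lra.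
  - by apply: dF; rewrite !ltW.
have [z] := MVT ab isd cF.
rewrite in_itv/= => /lu lDu ->.
have : 0 <= b - a by lra.
nra.
Qed.

Lemma derive_in_lipschitz (a b M : R) F D :
  (forall x, a <= x <= b -> derive_in `[a, b] F x (D x)) ->
  (forall x, a <= x <= b -> `|D x| <= M) ->
  forall x y, a <= x <= b -> a <= y <= b -> `|F x - F y| <= M * `|x - y|.
Proof.
move=> dF DM.
have main x y : a <= x -> x <= y -> y <= b -> `|F x - F y| <= M * `|x - y|.
  move=> ax xy yb.
  have /andP[h1 h2] : (- M) * (y - x) <= F y - F x <= M * (y - x).
    apply: (increment_bounds (D := D)) => // z zxy.
      apply: derive_in_sub (dF z _) => //=.
      - by move=> t /=; rewrite !in_itv/=; lra.
      - by move: zxy; lra.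
    by have := DM z; rewrite ler_norml; apply; move: zxy; lra.
  by rewrite distrC (distrC x) (ger0_norm (_ : 0 <= y - x)) ?subr_ge0// ler_norml; lra.
move=> x y /andP[ax xb] /andP[ay yb]; have [xy|/ltW yx] := leP x y.
  exact: main.
by rewrite distrC (distrC x); apply: main.
Qed.

(** Between [x] and the intermediate point [z] the slope of [F] is at most
    [D z]; between [z] and [y] it is at least [D z]. *)
Lemma nondecreasing_derive_convex (a b : R) F D :
  (forall x, a <= x <= b -> derive_in `[a, b] F x (D x)) ->
  (forall x y, a <= x -> x <= y -> y <= b -> D x <= D y) ->
  forall x y p, a <= x <= b -> a <= y <= b -> 0 <= p <= 1 ->
    F (p * x + (1 - p) * y) <= p * F x + (1 - p) * F y.
Proof.
move=> dF Dnd.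
have main x y p : a <= x -> x <= y -> y <= b -> 0 <= p <= 1 ->
    F (p * x + (1 - p) * y) <= p * F x + (1 - p) * F y.
  move=> ax xy yb /andP[p0 p1].
  pose z := p * x + (1 - p) * y; rewrite -/z.
  have xz : x <= z by rewrite /z; nra.
  have zy : z <= y by rewrite /z; nra.
  have dsub u v : a <= u -> v <= b -> forall t, u <= t <= v -> derive_in `[u, v] F t (D t).
    move=> au vb t tuv; apply: derive_in_sub (dF t _) => //=.
    - by move=> s /=; rewrite !in_itv/=; lra.
    - by move: tuv; lra.
  have /andP[_ h1] : D a * (z - x) <= F z - F x <= D z * (z - x).
    apply: (increment_bounds (D := D)) => //; first by apply: dsub; lra.
    by move=> t ?; rewrite !Dnd//; lra.
  have /andP[h2 _] : D z * (y - z) <= F y - F z <= D b * (y - z).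
    apply: (increment_bounds (D := D)) => //; first by apply: dsub; lra.
    by move=> t ?; rewrite !Dnd//; lra.
  have e1 : z - x = (1 - p) * (y - x) by rewrite /z; ring.
  have e2 : y - z = p * (y - x) by rewrite /z; ring.
  rewrite e1 in h1; rewrite e2 in h2.
  have := ler_wpM2l p0 h1.
  have q0 : 0 <= 1 - p by lra.
  have := ler_wpM2l q0 h2.
  set A := D z; nra.
move=> x y p /andP[ax xb] /andP[ay yb] p01; have [xy|/ltW yx] := leP x y.
  exact: main.
have := main y x (1 - p) ay yx xb.
have -> : 1 - (1 - p) = p by ring.
by rewrite ![(1 - p) * _ + _]addrC; apply; move: p01; lra.
Qed.

Lemma le_of_forall_slack (a z C : R) : 0 <= C ->
  (forall e, 0 < e <= 1 -> a <= z + C * e) -> a <= z.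
Proof.
move=> C0 H; rewrite leNgt; apply/negP => za.
pose e := Num.min 1 ((a - z) / 2 / (C + 1)).
have C1 : 0 < C + 1 by lra.
have e0 : 0 < e <= 1.
  by rewrite lt_min ltr01/= ge_min lexx divr_gt0// divr_gt0// subr_gt0.
have := H e e0.
have : e <= (a - z) / 2 / (C + 1) by rewrite ge_min lexx orbT.
rewrite ler_pdivlMr//; move: e0; nra.
Qed.

Lemma convex_combination_of_itv (a b x : R) : a <= x <= b ->
  exists2 p : R, 0 <= p <= 1 & x = p * a + (1 - p) * b.
Proof.
move=> /andP[ax xb]; have [ab|ab] := leP b a.
  by exists 1; [lra|lra].
exists ((b - x) / (b - a)); last by field; lra.
by rewrite divr_ge0 ?ler_pdivrMr ?mul1r//; lra.
Qed.

End Calculus.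

(** * Functions with Lipschitz increments *)

Section IncrementLipschitz.
Context {R : realType}.
Implicit Types x y z h e u d r rho p : R.
Variables (b B M : R) (Q : R -> R).
Hypotheses (B0 : 0 <= B) (M0 : 0 <= M).
Hypothesis Qlip : forall x y, 0 <= x <= b -> 0 <= y <= b ->
  `|Q x - Q y| <= M * `|x - y|.
Hypothesis Qinc : forall x y h, 0 <= x -> x <= y -> 0 <= h -> y + h <= b ->
  `|(Q (y + h) - Q y) - (Q (x + h) - Q x)| <= B * h * (y - x).

Let Qinc_abs x y h : 0 <= x -> 0 <= y -> 0 <= h -> x + h <= b -> y + h <= b ->
  `|(Q (y + h) - Q y) - (Q (x + h) - Q x)| <= B * h * `|y - x|.
Proof.
move=> x0 y0 h0 xb yb; have [xy|/ltW yx] := leP x y.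
  by rewrite (ger0_norm (_ : 0 <= y - x)) ?subr_ge0//; exact: Qinc.
by rewrite distrC (distrC y) (ger0_norm (_ : 0 <= x - y)) ?subr_ge0//; exact: Qinc.
Qed.

(* Tiling [[x, y]] by intervals of length [e], over each of which the increment
   of [Q] is close to its increment over [[u, u + e]]; the last tile is
   incomplete, whence the term [2 * M * e]. *)
Let tile x y u e rho : 0 <= x -> x <= y -> y <= b -> 0 <= u -> 0 < e ->
  u + e <= b -> `|x - u| <= rho -> `|y - u| <= rho ->
  `|Q y - Q x - (y - x) * ((Q (u + e) - Q u) / e)|
    <= B * rho * (y - x) + 2 * M * e.
Proof.
move=> x0 xy yb u0 e0 ueb xu yu.
set g := Q (u + e) - Q u.
have tiles (n : nat) : x + n%:R * e <= y ->
    `|Q (x + n%:R * e) - Q x - n%:R * g| <= B * e * rho * n%:R.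
  elim: n => [|n IH].
    by rewrite !mul0r addr0 !subrr normr0 mulr0.
  rewrite -natr1 => le1.
  have n0 : 0 <= n%:R :> R by [].
  have le2 : x + n%:R * e <= y by nra.
  have le3 : 0 <= x + n%:R * e by nra.
  have ix : `|x + n%:R * e - u| <= rho.
    by move: xu yu; rewrite !ler_norml; nra.
  have := Qinc_abs u0 le3 (ltW e0) ueb.
  have -> : x + n%:R * e + e = x + (n%:R + 1) * e by ring.
  rewrite -/g => /(_ (le_trans le1 yb)) h.
  have -> : Q (x + (n%:R + 1) * e) - Q x - (n%:R + 1) * g =
    (Q (x + (n%:R + 1) * e) - Q (x + n%:R * e) - g)
    + (Q (x + n%:R * e) - Q x - n%:R * g) by ring.
  rewrite (le_trans (ler_normD _ _))//.
  have -> : B * e * rho * (n%:R + 1) = B * e * rho + B * e * rho * n%:R by ring.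
  rewrite lerD ?IH//.
  by rewrite (le_trans h)// ler_wpM2l// mulr_ge0// ltW.
pose n := Num.truncn ((y - x) / e).
have yxe0 : 0 <= (y - x) / e by rewrite divr_ge0 ?subr_ge0// ltW.
have /andP[nlo nhi] := truncn_itv yxe0.
rewrite -/n ler_pdivlMr// in nlo; rewrite -/n ltr_pdivrMr// -natr1 in nhi.
have xne : x + n%:R * e <= y by lra.
have n0 : 0 <= n%:R :> R by [].
have h1 := tiles n xne.
have h2 : `|Q y - Q (x + n%:R * e)| <= M * e.
  apply: le_trans (Qlip _ _) _; [lra|nra|].
  by rewrite ler_wpM2l// ger0_norm; lra.
have ge : `|g / e| <= M.
  rewrite normrM normfV (gtr0_norm e0) ler_pdivrMr//.
  apply: le_trans (Qlip _ _) _; [lra|lra|].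
  by rewrite addrC addKr (gtr0_norm e0).
have h3 : `|(y - x - n%:R * e) * (g / e)| <= M * e.
  rewrite normrM ger0_norm; last by lra.
  rewrite mulrC; apply: ler_pM => //; lra.
have -> : Q y - Q x - (y - x) * (g / e) =
  (Q y - Q (x + n%:R * e)) + (Q (x + n%:R * e) - Q x - n%:R * g)
  - (y - x - n%:R * e) * (g / e) by field; rewrite gt_eqF.
have rho0 : 0 <= rho by apply: le_trans xu.
have h4 : B * e * rho * n%:R <= B * rho * (y - x).
  have -> : B * e * rho * n%:R = B * rho * (n%:R * e) by ring.
  by rewrite ler_wpM2l// mulr_ge0.
apply: le_trans (ler_normB _ _) _.
apply: le_trans (lerD (ler_normD _ _) (lexx _)) _.
lra.
Qed.

Let slope_limit z : 0 < b -> 0 <= z <= b -> exists2 d : R, `|d| <= M &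
  forall x y : R, 0 <= x -> x <= y -> y <= b -> x = z \/ y = z ->
    `|Q y - Q x - d * (y - x)| <= B * (y - x) ^+ 2.
Proof.
move=> b0 /andP[z0 zb].
(* An interval of length [e] inside [[0, b]] that contains [z]. *)
pose u e := Num.min z (b - e).
pose p e := (Q (u e + e) - Q (u e)) / e.
have uP e : 0 < e -> e < b -> [/\ 0 <= u e, u e + e <= b & `|z - u e| <= e].
  move=> e0 eb; rewrite /u minEle; case: ifPn => h; split; try lra.
    by rewrite subrr normr0 ltW.
  rewrite -ltNge in h; rewrite ger0_norm; lra.
have [d [dM cl]] : `[- M, M] `&` cluster (p @ 0^'+) !=set0.
  apply: (@segment_compact R (- M) M) => //.
  rewrite /= nbhs_simpl; near=> e.
  have e0 : 0 < e by near: e; exact: nbhs_right_gt.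
  have eb : e < b by near: e; exact: nbhs_right_lt.
  have [u0 ub _] := uP e e0 eb.
  rewrite /= in_itv/= -ler_norml normrM normfV (gtr0_norm e0) ler_pdivrMr//.
  apply: le_trans (Qlip _ _) _; [lra|lra|].
  by rewrite addrC addKr (gtr0_norm e0).
exists d; first by move: dM; rewrite /= in_itv/= ler_norml.
move=> x y x0 xy yb xyz.
have C0 : 0 <= B * (y - x) + 2 * M + (y - x).
  rewrite addr_ge0 ?subr_ge0// addr_ge0// mulr_ge0// subr_ge0//.
apply: (le_of_forall_slack C0) => e /andP[e0 e1].
have [s [[r [r0 rb re] <-]]] :
    (p @` [set r | [/\ 0 < r, r < b & r <= e]]) `&` ball d e !=set0.
  apply: cl; last exact: nbhsx_ballx.
  rewrite /= nbhs_simpl; near=> r; exists r => //; split; near: r.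
  - exact: nbhs_right_gt.
  - exact: nbhs_right_lt.
  - exact: nbhs_right_le.
rewrite /ball/= => dpe.
have [u0 ub zu] := uP r r0 rb.
have xy0 : `|y - x| = y - x by rewrite ger0_norm// subr_ge0.
have h := @tile x y (u r) r ((y - x) + r) x0 xy yb u0 r0 ub.
have {}h : `|Q y - Q x - (y - x) * p r| <= B * ((y - x) + r) * (y - x) + 2 * M * r.
  apply: h; move: zu; case: xyz => <-; rewrite !ler_norml; lra.
have -> : Q y - Q x - d * (y - x) =
  (Q y - Q x - (y - x) * p r) + (p r - d) * (y - x) by ring.
apply: le_trans (ler_normD _ _) _; rewrite normrM xy0.
have h2 : `|p r - d| * (y - x) <= e * (y - x).
  by rewrite ler_wpM2r ?subr_ge0// distrC ltW.
apply: le_trans (lerD h h2) _; 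
have : B * (y - x) * r <= B * (y - x) * e by rewrite ler_wpM2l// mulr_ge0// subr_ge0.
have : M * r <= M * e by rewrite ler_wpM2l.
by rewrite expr2; lra.
Unshelve. all: by end_near. Qed.

(** A cluster point of the difference quotients at [z] is the derivative at
    [z]: tiling an interval with end point [z] by increments close to those at
    [z] bounds the error quadratically in the length of the interval.  The
    derivative inherits the constant [B] because the increments over [[x, x + h]]
    and [[y - h, y]] differ by at most [B h (y - x)]. *)
Lemma increment_lipschitz_derive : exists D : R -> R,
  [/\ forall x, 0 <= x <= b -> derive_in `[0, b] Q x (D x),
      forall x, 0 <= x <= b -> `|D x| <= M
    & forall x y, 0 <= x <= b -> 0 <= y <= b -> `|D x - D y| <= B * `|x - y|].
Proof.
have [b0|b0] := leP b 0.
  exists (fun=> 0); split=> [x xb|x xb|x y xb yb].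
  - apply/derive_inP => e e0; exists 1 => // y /=; rewrite in_itv/= => yb _.
    have -> : y = x by lra.
    by rewrite !subrr mul0r subr0 normr0 mulr0.
  - by rewrite normr0.
  - by rewrite subrr normr0 mulr_ge0.
have /choice[D DP] : forall z : R, exists d : R, 0 <= z <= b -> `|d| <= M /\
    forall x y : R, 0 <= x -> x <= y -> y <= b -> x = z \/ y = z ->
    `|Q y - Q x - d * (y - x)| <= B * (y - x) ^+ 2.
  move=> z; have [zb|zb] := boolP (0 <= z <= b); last by exists 0.
  by have [d dM dP] := slope_limit b0 zb; exists d.
have DlipW (x y : R) : 0 <= x -> x < y -> y <= b -> `|D y - D x| <= B * (y - x).
  move=> x0 xy yb.
  have xb : 0 <= x <= b by lra.
  have yb' : 0 <= y <= b by lra.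
  apply: (@le_of_forall_slack _ _ _ (2 * B * (y - x))).
    by rewrite !mulr_ge0//; lra.
  move=> e /andP[e0 e1].
  have [h [hE h0 hyx]] : exists h, [/\ h = e * (y - x), 0 < h & h <= y - x].
    by exists (e * (y - x)); split => //; [rewrite mulr_gt0// subr_gt0|nra].
  have [_ /(_ x (x + h))] := DP x xb.
  rewrite (_ : x + h - x = h); last by ring.
  move=> /(_ x0 _ _ (or_introl erefl)) H1.
  have [_ /(_ (y - h) y)] := DP y yb'.
  rewrite (_ : y - (y - h) = h); last by ring.
  move=> /(_ _ _ yb (or_intror erefl)) H2.
  have := @Qinc x (y - h) h; rewrite subrK => /(_ x0 _ (ltW h0) yb) H3.
  have {}H1 : `|Q (x + h) - Q x - D x * h| <= B * h ^+ 2 by apply: H1; lra.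
  have {}H2 : `|Q y - Q (y - h) - D y * h| <= B * h ^+ 2 by apply: H2; lra.
  have {}H3 : `|Q y - Q (y - h) - (Q (x + h) - Q x)| <= B * h * (y - h - x).
    by apply: H3; lra.
  rewrite -(ler_pM2r h0) -{1}(gtr0_norm h0) -normrM.
  have -> : (D y - D x) * h = (Q y - Q (y - h) - (Q (x + h) - Q x))
    - (Q y - Q (y - h) - D y * h) + (Q (x + h) - Q x - D x * h) by ring.
  apply: le_trans (ler_normD _ _) _.
  apply: le_trans (lerD (ler_normB _ _) (lexx _)) _.
  apply: le_trans (lerD (lerD H3 H2) H1) _.
  have : 0 <= B * h * h by rewrite !mulr_ge0// ltW.
  have -> : 2 * B * (y - x) * e = 2 * B * h by rewrite hE; ring.
  by rewrite expr2; lra.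
exists D; split=> [x xb|x /DP[]//|x y xb yb].
- apply/derive_inP => e e0; exists (e / (B + 1)).
    by rewrite divr_gt0// ltr_wpDl.
  move=> y /=; rewrite in_itv/= => yb; rewrite ltr_pdivlMr ?ltr_wpDl// => yxe.
  have [_ H] := DP x xb.
  have {}H : `|Q y - Q x - D x * (y - x)| <= B * `|y - x| ^+ 2.
    have [xy|/ltW yx] := leP x y.
      by rewrite (ger0_norm (_ : 0 <= y - x)) ?subr_ge0//; apply: H; [lra| |lra|left].
    rewrite distrC (distrC y) (ger0_norm (_ : 0 <= x - y)) ?subr_ge0//.
    have -> : D x * (y - x) - (Q y - Q x) = Q x - Q y - D x * (x - y) by ring.
    by apply: H; [lra| |lra|right].
  apply: le_trans H _.
  have : 0 <= `|y - x| by [].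
  rewrite expr2; nra.
- have [xy|yx|->] := ltgtP x y.
  + by rewrite distrC (distrC x) (gtr0_norm (_ : 0 < y - x)) ?subr_gt0//; apply: DlipW; lra.
  + by rewrite (gtr0_norm (_ : 0 < x - y)) ?subr_gt0//; apply: DlipW; lra.
  + by rewrite !subrr normr0 mulr0.
Qed.

End IncrementLipschitz.

(** * Expectations under a Lipschitz density *)

Section LipschitzFunctions.
Context {R : realType}.
Implicit Types (V : R -> R) (a b x M : R).

Lemma klipschitz_cont V M : (forall a b, `|V a - V b| <= M * `|a - b|) ->
  continuous V.
Proof.
move=> Vlip x; apply/cvgrPdist_le => e e0.
have M1 : 0 < `|M| + 1 by rewrite ltr_wpDl.
near=> y; apply: le_trans (Vlip _ _) _.
have : `|x - y| <= e / (`|M| + 1).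
  near: y; rewrite nearE; apply/nbhs_ballP; exists (e / (`|M| + 1)) => /=.
    by rewrite divr_gt0.
  by move=> y /= /ltW.
rewrite ler_pdivlMr// mulrC; apply: le_trans.
by rewrite ler_wpM2r// ler_wpDr// ler_norm.
Unshelve. all: by end_near. Qed.

Lemma klipschitz_measurable V M : (forall a b, `|V a - V b| <= M * `|a - b|) ->
  measurable_fun setT V.
Proof. by move=> /klipschitz_cont/continuous_measurable_fun. Qed.

End LipschitzFunctions.

Lemma lebesgue_measure_translate (R : realType) (a : R)
    (A : set (measurableTypeR R)) : measurable A ->
  pushforward (@lebesgue_measure R)
    ((fun v => v - a) : _ -> measurableTypeR R) A = lebesgue_measure A.
Proof.
have mt : measurable_fun setT ((fun v => v - a) : measurableTypeR R -> measurableTypeR R).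
  exact: measurable_funB.
pose mt_mixin := isMeasurableFun.Build _ _ _ _ _ mt.
pose mt_pack : {mfun _ >-> _} :=
  HB.pack ((fun v => v - a) : measurableTypeR R -> measurableTypeR R) mt_mixin.
move=> mA; apply/esym.
apply: (@lebesgue_measure_unique _ (pushforward (@lebesgue_measure R) mt_pack))
  => //= _ [[u v]] _ <-.
rewrite /pushforward/=.
have -> : (fun v => v - a) @^-1` `]u, v] = `]u + a, v + a]%classic.
  by apply/seteqP; split=> y /=; rewrite !in_itv/= ltrBrDr lerBlDr.
rewrite !lebesgue_measure_itv/= !lte_fin ltrD2r.
by case: ifPn => // _; congr (_%:E); ring.
Qed.

Lemma integral_translate (R : realType) (g : R -> R) (a : R) :
  (@lebesgue_measure R).-integrable setT (EFin \o g) ->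
  (@lebesgue_measure R).-integrable setT (EFin \o (fun v => g (v - a))) /\
  (\int[@lebesgue_measure R]_v (g (v - a))%:E
    = \int[@lebesgue_measure R]_v (g v)%:E)%E.
Proof.
move=> ig.
have mt : measurable_fun setT ((fun v => v - a) : measurableTypeR R -> measurableTypeR R).
  exact: measurable_funB.
have mg := measurable_int _ ig.
have mga : measurable_fun setT (EFin \o (fun v : measurableTypeR R => g (v - a))).
  exact: (measurableT_comp mg mt).
have iga : (@lebesgue_measure R).-integrable setT (EFin \o (fun v => g (v - a))).
  apply/integrableP; split => //.
  case/integrableP : ig => _; apply: le_lt_trans.
  rewrite le_eqVlt; apply/orP; left; apply/eqP.
  rewrite -[RHS](eq_measure_integral _ (fun A mA _ => lebesgue_measure_translate a mA)).
  rewrite ge0_integral_pushforward//.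
  exact: measurableT_comp.
split=> //.
rewrite -[RHS](eq_measure_integral _ (fun A mA _ => lebesgue_measure_translate a mA)).
by rewrite integral_pushforward.
Qed.

Section Density.
Context {R : realType}.
Local Notation lambda := (@lebesgue_measure R).
Variables (mu : probability (measurableTypeR R) R) (f : R -> R) (L Pf : R).
Hypotheses (f0 : forall y, 0 <= f y)
  (muE : forall B : set (measurableTypeR R), measurable B ->
     mu B = (\int[lambda]_(y in B) (f y)%:E)%E)
  (f_lt0 : forall y, y < 0 -> f y = 0)
  (L0 : 0 <= L) (f_lip : L.-lipschitz_`[0, +oo[ f)
  (P0 : 0 <= Pf) (fP : forall y, 0 <= y -> `|f y| <= Pf).
Implicit Types (V g : R -> R) (x y z h a M cmax : R).

Let f_klip x y : 0 <= x -> 0 <= y -> `|f x - f y| <= L * `|x - y|.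
Proof.
by move=> x0 y0; have := @f_lip (x, y); rewrite /= !in_itv/= !andbT; apply.
Qed.

Lemma measurable_density : measurable_fun [set: measurableTypeR R] f.
Proof.
have -> : f = (fun y => f (Num.max y 0) * \1_(`[0, +oo[ : set R) y).
  apply/funext => y; rewrite indicE; have [y0|y0] := leP 0 y.
    by rewrite mem_set ?mulr1// /= in_itv/= y0.
  by rewrite memNset ?mulr0 ?f_lt0//= in_itv/= leNgt y0.
apply: measurable_funM; last exact: measurable_indic.
apply: (@klipschitz_measurable _ _ L) => a b.
have ab : `|Num.max a 0 - Num.max b 0| <= `|a - b|.
  by rewrite !maxEle; case: ifPn => ha; case: ifPn => hb; rewrite ler_norml;
    (have := ler_norm (a - b)); (have := ler_norm (b - a)); rewrite (distrC b); lra.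
apply: le_trans (f_klip _ _) _; rewrite ?le_max ?lexx ?orbT//.
by rewrite ler_wpM2l.
Qed.

Lemma density_integrable : lambda.-integrable setT (EFin \o f).
Proof.
apply/integrableP; split.
  by apply/measurable_EFinP; exact: measurable_density.
under eq_integral do rewrite /= ger0_norm//.
by rewrite -muE// probability_setT ltry.
Qed.

(** The density [f] is a Radon-Nikodym derivative of [mu], because both have the
    same integral over every measurable set. *)
Lemma density_integral g a : measurable_fun setT g -> (forall x, `|g x| <= a) ->
  (\int[mu]_x (g x)%:E = \int[lambda]_x (g x * f x)%:E)%E.
Proof.
move=> mg ga.
have dom : mu `<< lambda.
  apply/null_content_dominatesP => A mA muA0; rewrite muE//.
  apply: null_set_integral => //; apply: measurable_funTS.
  by apply/measurable_EFinP; exact: measurable_density.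
have mu_g : mu.-integrable setT (EFin \o g).
  apply: measurable_bounded_integrable => //.
    by rewrite -ge0_fin_numE//; exact: fin_num_measure.
  by exists a; split; [exact: num_real|move=> b ab x _; apply: le_trans (ga x) (ltW ab)].
rewrite -(Radon_Nikodym_change_of_variables dom)//.
apply: ae_eq_integral => //.
- apply: emeasurable_funM; first exact/measurable_EFinP.
  apply: (measurable_int lambda); exact: Radon_Nikodym_integrable.
- apply/measurable_EFinP/measurable_funM => //; exact: measurable_density.
- under [X in ae_eq _ _ _ X]eq_fun do rewrite EFinM.
  apply: ae_eqe_mul2l.
  apply: integral_ae_eq => //.
  + exact: Radon_Nikodym_integrable.
  + by apply/measurable_EFinP; exact: measurable_density.
  + by move=> E _ mE; rewrite -Radon_Nikodym_integral// -muE.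
Qed.

Definition mean (V : R -> R) y : R := \int[mu]_v V (y - (v : R)).

Section Mean.
Variables (V : R -> R) (M a : R).
Hypotheses (M0 : 0 <= M) (V_lip : forall x y, `|V x - V y| <= M * `|x - y|)
  (V_bound : forall x, `|V x| <= a).

Let measurable_shift y : measurable_fun setT (fun v : measurableTypeR R => V (y - v)).
Proof.
apply: (@measurableT_comp _ _ _ _ _ _ V _ (fun v : measurableTypeR R => y - v)).
  exact: klipschitz_measurable V_lip.
exact: measurable_funB.
Qed.

Lemma mean_integrable y :
  mu.-integrable setT (EFin \o (fun v : measurableTypeR R => V (y - v))).
Proof.
apply: measurable_bounded_integrable => //.
  by rewrite -ge0_fin_numE//; exact: fin_num_measure.
by exists a; split; [exact: num_real|move=> b ab x _; apply: le_trans (V_bound _) (ltW ab)].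
Qed.

Lemma mean_lipschitz x y : `|mean V x - mean V y| <= M * `|x - y|.
Proof.
rewrite /mean -RintegralB//; [|exact: mean_integrable..].
apply: le_trans (le_normr_Rintegral _ _) _ => //.
  by apply: (integrableB _ (mean_integrable x) (mean_integrable y)).
apply: le_trans (le_Rintegral (f2 := cst (M * `|x - y|)) _ _ _ _) _ => //=.
- by apply: integrable_norm; apply: (integrableB _ (mean_integrable x) (mean_integrable y)).
- exact: finite_measure_integrable_cst.
- move=> v _; apply: le_trans (V_lip _ _) _.
  by rewrite (_ : x - v - (y - v) = x - y)//; ring.
- by rewrite Rintegral_cst// [X in fine X](_ : _ = 1%E) ?mulr1//; exact: probability_setT.
Qed.

(** The increment of [mean V] over [[y, y + h]] integrates an increment of [V],
    which is at most [M h], against the density.  For the increment over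
    [[x, x + h]] a translation by [d = y - x] gives the same integrand against
    the translated density.  The two densities differ by at most [Pf] on
    [[0, d]] and by at most [L d] on [[d, d + cmax]]; beyond, the increment of
    [V] vanishes. *)
Lemma mean_increment cmax x y h : (forall z, z <= 0 -> V z = V 0) ->
  0 <= x -> x <= y -> 0 <= h -> y + h <= cmax ->
  `|(mean V (y + h) - mean V y) - (mean V (x + h) - mean V x)|
    <= (L * cmax + Pf) * M * h * (y - x).
Proof.
move=> V_cst x0 xy h0 yh.
have cmax0 : 0 <= cmax by lra.
pose d := y - x; have d0 : 0 <= d by rewrite subr_ge0.
pose G z (v : measurableTypeR R) := V (z + h - v) - V (z - v).
have mG z : measurable_fun setT (G z) by exact: measurable_funB.
have GMh z v : `|G z v| <= M * h.
  apply: le_trans (V_lip _ _) _.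
  by rewrite (_ : z + h - v - (z - v) = h) ?ger0_norm//; ring.
have Gf_int z : lambda.-integrable setT (EFin \o (fun v => G z v * f v)).
  apply: (@le_integrable _ _ _ lambda setT measurableT _
    (EFin \o (fun v => M * h * f v))) => //.
  - by apply/measurable_EFinP/measurable_funM => //; exact: measurable_density.
  - move=> v _ /=; rewrite lee_fin normrM [leRHS]normrM; apply: ler_wpM2r => //.
    by apply: le_trans (GMh z v) (ler_norm _).
  - exact: (integrableZl _ (M * h) density_integrable).
have mean_incr z : mean V (z + h) - mean V z = \int[lambda]_v (G z v * f v).
  rewrite /mean -RintegralB//; [|exact: mean_integrable..].
  by rewrite /Rintegral (density_integral (mG z) (GMh z)).
rewrite !mean_incr.
have [G'f_int G'f] := integral_translate d (Gf_int x).
have {G'f} -> : \int[lambda]_v (G x v * f v) = \int[lambda]_v (G y v * f (v - d)).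
  rewrite /Rintegral -G'f; congr fine; apply: eq_integral => v _.
  by rewrite /G (_ : x + h - (v - d) = y + h - v) 1?(_ : x - (v - d) = y - v)//
    /d; ring.
have {}G'f_int : lambda.-integrable setT (EFin \o (fun v => G y v * f (v - d))).
  apply: eq_integrable G'f_int => // v _ /=; congr (_%:E).
  by rewrite /G (_ : x + h - (v - d) = y + h - v) 1?(_ : x - (v - d) = y - v)//
    /d; ring.
rewrite -RintegralB//.
apply: le_trans (le_normr_Rintegral _ _) _ => //.
  exact: (integrableB _ (Gf_int y) G'f_int).
pose A : set (measurableTypeR R) := `[0, d]%classic.
pose B : set (measurableTypeR R) := `[d, d + cmax]%classic.
pose q v := M * h * Pf * \1_A v + M * h * (L * d) * \1_B v.
have qA : lambda.-integrable setT (EFin \o (fun v => M * h * Pf * \1_A v)).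
  exact: (integrableZl _ _ (integrable_indic_itv 0 d true false)).
have qB : lambda.-integrable setT (EFin \o (fun v => M * h * (L * d) * \1_B v)).
  exact: (integrableZl _ _ (integrable_indic_itv d (d + cmax) true false)).
apply: le_trans (le_Rintegral (f2 := q) _ _ _ _) _ => //=.
- by apply: integrable_norm; exact: (integrableB _ (Gf_int y) G'f_int).
- exact: (integrableD _ qA qB).
- move=> v _; rewrite -mulrBr normrM.
  have Mh0 : 0 <= M * h by rewrite mulr_ge0.
  have Ld0 : 0 <= L * d by rewrite mulr_ge0.
  have A0 : 0 <= \1_A v :> R by rewrite indicE.
  have B0 : 0 <= \1_B v :> R by rewrite indicE.
  have q0 : 0 <= q v by rewrite /q addr_ge0// mulr_ge0// mulr_ge0.
  have [v0|v0] := ltP v 0.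
    by rewrite !f_lt0 ?subrr ?normr0 ?mulr0//; lra.
  have [vd|vd] := ltP v d.
    rewrite (f_lt0 (_ : v - d < 0)) ?subr_lt0// subr0.
    have vA : v \in A by rewrite inE /A /= in_itv/= v0 ltW.
    rewrite /q [\1_A v]indicE vA mulr1; apply: ler_wpDr; first by rewrite mulr_ge0// mulr_ge0.
    by apply: ler_pM => //; exact: fP.
  have [vB|vB] := leP v (d + cmax); last first.
    by rewrite /G !V_cst ?subrr ?normr0 ?mul0r//; rewrite /d in vB; lra.
  have {}vB : v \in B by rewrite inE /B /= in_itv/= vd.
  rewrite /q [\1_B v]indicE vB mulr1; apply: ler_wpDl; first by rewrite mulr_ge0// mulr_ge0.
  apply: ler_pM => //; apply: le_trans (f_klip _ _) _ => //; first by lra.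
  by rewrite (_ : v - (v - d) = d) ?ger0_norm//; ring.
- have Rindic u v : u <= v ->
      \int[lambda]_z \1_(`[u, v]%classic : set (measurableTypeR R)) z = v - u.
    move=> uv; rewrite /Rintegral integral_indic// setIT.
    rewrite [X in fine X](@lebesgue_measure_itv R `[u, v])/= lte_fin.
    by case: ltgtP uv => // ->; rewrite subrr.
  rewrite /q RintegralD// !RintegralZl//; [|exact: integrable_indic_itv..].
  rewrite !Rindic// ?lerDl// /d.
  by rewrite le_eqVlt; apply/orP; left; apply/eqP; ring.
Qed.

End Mean.

End Density.

(** * Ordering and resetting in one stage *)

Section Thresholds.
Context {R : realType}.
Implicit Types (F : R -> R) (a b x y z u v A p s S : R).

Lemma lipschitz_first_nonpos b A F : 0 <= A ->
  (forall x y, 0 <= x <= b -> 0 <= y <= b -> `|F x - F y| <= A * `|x - y|) ->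
  (exists2 x, 0 <= x <= b & F x <= 0) ->
  exists a, [/\ 0 <= a <= b, F a <= 0
    & forall x, 0 <= x <= b -> F x <= 0 -> a <= x].
Proof.
move=> A0 Flip [x0 x0b Fx0].
pose E : set R := [set x | 0 <= x <= b /\ F x <= 0].
have Einf : has_inf E.
  by split; [exists x0|exists 0 => x [/andP[]]].
have aE x : 0 <= x <= b -> F x <= 0 -> inf E <= x.
  by move=> xb Fx; apply: ge_inf; [case: Einf|split].
have ab : 0 <= inf E <= b.
  rewrite lb_le_inf ?(le_trans (aE _ x0b Fx0)) ?(andP x0b).2//.
    by exists x0.
  by move=> x [/andP[]].
exists (inf E); split => //.
apply: (le_of_forall_slack A0) => e /andP[e0 _].
have [z [zb Fz] ze] := inf_adherent e0 Einf.
have az := aE z zb Fz.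
have := Flip _ _ ab zb.
rewrite add0r (distrC (inf E)) (ger0_norm (_ : 0 <= z - inf E)) ?subr_ge0// ler_norml.
have : A * (z - inf E) <= A * e by rewrite ler_wpM2l// lerBlDl ltW.
lra.
Qed.

Lemma lipschitz_last_nonpos b A F : 0 <= A ->
  (forall x y, 0 <= x <= b -> 0 <= y <= b -> `|F x - F y| <= A * `|x - y|) ->
  (exists2 x, 0 <= x <= b & F x <= 0) ->
  exists a, [/\ 0 <= a <= b, F a <= 0
    & forall x, 0 <= x <= b -> F x <= 0 -> x <= a].
Proof.
move=> A0 Flip [x0 x0b Fx0].
have [x y xb yb||a [ab Fa aP]] :=
    @lipschitz_first_nonpos b A (fun x => F (b - x)) A0.
- rewrite (_ : x - y = - (b - x - (b - y))); last by ring.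
  by rewrite normrN; apply: Flip; lra.
- by exists (b - x0); [lra|rewrite subKr].
exists (b - a); split => //; first by lra.
move=> x xb Fx; have := aP (b - x); rewrite subKr => /(_ _ Fx); lra.
Qed.

Variables (cmax c K A : R) (Phi : R -> R).
Hypotheses (cmax0 : 0 <= cmax) (c0 : 0 <= c) (K0 : 0 <= K) (A0 : 0 <= A).
Hypothesis Phi_lip : forall x y, 0 <= x <= cmax -> 0 <= y <= cmax ->
  `|Phi x - Phi y| <= A * `|x - y|.
Hypothesis Phi_convex : forall x y p, 0 <= x <= cmax -> 0 <= y <= cmax ->
  0 <= p <= 1 -> Phi (p * x + (1 - p) * y) <= p * Phi x + (1 - p) * Phi y.

Definition order_cost x u : R := c * u + K * (0 < u)%R%:R + Phi (x + u).

Definition optimal_order x u :=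
  0 <= u <= cmax - x /\
  forall v, 0 <= v <= cmax - x -> order_cost x u <= order_cost x v.

(** Apart from the fixed cost, ordering up to the level [y] from the stock [x]
    costs [up_to_cost y - c x], so that the best level does not depend on [x]. *)
Definition up_to_cost y : R := c * y + Phi y.
Local Notation G := up_to_cost.

Let G_nonincreasing S x y : 0 <= S <= cmax ->
  (forall z, 0 <= z <= cmax -> G S <= G z) -> 0 <= x -> x <= y -> y <= S -> G y <= G x.
Proof.
move=> Sc Smin x0 xy yS.
have [p p01 yE] := @convex_combination_of_itv _ x S y (introT andP (conj xy yS)).
have xc : 0 <= x <= cmax by lra.
have := Phi_convex xc Sc p01; rewrite -yE => Py.
have Sx := Smin x xc.
have -> : G y = c * (p * x + (1 - p) * S) + Phi y by rewrite -yE.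
move: Sx; rewrite /up_to_cost; clear yE; nra.
Qed.

Let G_nondecreasing S x y : 0 <= S <= cmax ->
  (forall z, 0 <= z <= cmax -> G S <= G z) -> S <= x -> x <= y -> y <= cmax -> G x <= G y.
Proof.
move=> Sc Smin Sx xy yc.
have [p p01 xE] := @convex_combination_of_itv _ S y x (introT andP (conj Sx xy)).
have yc' : 0 <= y <= cmax by lra.
have := Phi_convex Sc yc' p01; rewrite -xE => Px.
have Sy := Smin y yc'.
have -> : G x = c * (p * S + (1 - p) * y) + Phi x by rewrite -xE.
move: Sy; rewrite /up_to_cost; clear xE; nra.
Qed.

Lemma order_costE x u : order_cost x u = G (x + u) + K * (0 < u)%R%:R - c * x.
Proof. by rewrite /order_cost /G; ring. Qed.

(** [S] minimises the convex function [up_to_cost], which decreases before [S];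
    an order pays for the fixed cost [K] as long as this function exceeds its
    minimum by more than [K]. *)
Lemma sS_optimal : exists s S, [/\ 0 <= s <= S, S <= cmax,
    forall x, 0 <= x -> x < s -> optimal_order x (S - x)
  & forall x, s <= x -> x <= cmax -> optimal_order x 0].
Proof.
have G_lip x y : 0 <= x <= cmax -> 0 <= y <= cmax ->
    `|G x - G y| <= (c + A) * `|x - y|.
  move=> xc yc; rewrite /up_to_cost (_ : _ - _ = c * (x - y) + (Phi x - Phi y)); last by ring.
  apply: le_trans (ler_normD _ _) _; rewrite normrM (ger0_norm c0) mulrDl.
  by rewrite lerD2l; exact: Phi_lip.
have cA0 : 0 <= c + A by rewrite addr_ge0.
have [S Sc Smin] : exists2 S, 0 <= S <= cmax & forall z, 0 <= z <= cmax -> G S <= G z.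
  have cont : {within `[0, cmax], continuous G}.
    apply/subspace_continuousP => x /=; rewrite in_itv/= => xc.
    apply/cvgrPdist_le => e e0; rewrite /prop_near1 /within/=.
    have cA1 : 0 < c + A + 1 by rewrite ltr_wpDl.
    exists (e / (c + A + 1)); first by rewrite /= divr_gt0.
    move=> y; rewrite /ball_/= => yx; rewrite in_itv/= => yc.
    apply: le_trans (G_lip _ _ xc yc) _.
    move: yx; rewrite ltr_pdivlMr// => /ltW; rewrite mulrDr mulr1 mulrC.
    have : 0 <= `|x - y| by [].
    lra.
  have [S] := EVT_min cmax0 cont; rewrite in_itv/= => Sc Smin.
  by exists S => // z zc; apply: Smin; rewrite in_itv.
have [x y xS yS||s [sS Gs sP]] :=
    @lipschitz_first_nonpos S (c + A) (fun x => G x - (K + G S)) cA0.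
- by rewrite (_ : _ - _ = G x - G y); [apply: G_lip; lra|ring].
- exists S; first by lra.
  by rewrite opprD addrCA subrr addr0 oppr_le0.
exists s, S; split => //; try lra.
- move=> x x0 xs; split; first by lra.
  move=> v vc; rewrite !order_costE subrKC.
  have -> : 0 < S - x by lra.
  rewrite mulr1 lerD2r; case: (ltgtP 0 v) vc => [v0|v0|<-] vc.
  + by rewrite mulr1 lerD2r; apply: Smin; lra.
  + lra.
  + rewrite mulr0 !addr0 leNgt; apply/negP => h.
    have : s <= x by apply: sP; lra.
    lra.
- move=> x sx xc; split; first by lra.
  move=> v vc; rewrite !order_costE ltxx mulr0 !addr0 lerD2r.
  case: (ltgtP 0 v) vc => [v0|v0|<-] vc; rewrite ?mulr1 ?mulr0 ?addr0; [|lra|by []].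
  have [xS|Sx] := leP x S.
    have : G x <= G s by apply: (G_nonincreasing Sc Smin); lra.
    have : G S <= G (x + v) by apply: Smin; lra.
    lra.
  have h : G x <= G (x + v) by apply: (G_nondecreasing Sc Smin); lra.
  by apply: le_trans h _; rewrite lerDl.
Qed.

Definition best_order_cost x : R :=
  inf [set order_cost x u | u in [set u | 0 <= u <= cmax - x]].

Lemma best_order_costE x u : optimal_order x u ->
  best_order_cost x = order_cost x u.
Proof.
move=> [xu umin]; apply/eqP; rewrite eq_le; apply/andP; split.
  by apply: ge_inf; [exists (order_cost x u) => _ [v + <-]; exact: umin|exists u].
by apply: lb_le_inf; [exists (order_cost x u), u|move=> _ [v + <-]; exact: umin].
Qed.

Lemma optimal_order_exists x : 0 <= x <= cmax -> exists u, optimal_order x u.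
Proof.
have [s [S [sS Sc lo hi]]] := sS_optimal; move=> /andP[x0 xc].
by have [xs|sx] := ltP x s; [exists (S - x); exact: lo|exists 0; exact: hi].
Qed.

Lemma best_order_cost_le x u : 0 <= x <= cmax -> 0 <= u <= cmax - x ->
  best_order_cost x <= order_cost x u.
Proof.
move=> xc uc; have [v vopt] := optimal_order_exists xc.
by rewrite (best_order_costE vopt); apply: vopt.2.
Qed.

(** An order from one stock up to some level is matched by an order from the
    other stock up to the same level or, if this level lies below the other
    stock, by no order. *)
Lemma best_order_cost_lipschitz x y : 0 <= x <= cmax -> 0 <= y <= cmax ->
  `|best_order_cost x - best_order_cost y| <= (c + A) * `|x - y|.
Proof.
wlog xy : x y / x <= y.
  move=> H xc yc; have [xy|/ltW yx] := leP x y; first exact: H.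
  by rewrite distrC (distrC x); apply: H.
move=> xc yc; rewrite (distrC x) (ger0_norm (_ : 0 <= y - x)) ?subr_ge0//.
have [u uopt] := optimal_order_exists xc.
have [v vopt] := optimal_order_exists yc.
have A1 : 0 <= A * (y - x) by rewrite mulr_ge0// subr_ge0.
have c1 : 0 <= c * (y - x) by rewrite mulr_ge0// subr_ge0.
have key1 : best_order_cost y <= best_order_cost x + (c + A) * (y - x).
  have [uc _] := uopt; rewrite (best_order_costE uopt).
  have [yxu|yxu] := leP y (x + u).
    apply: (le_trans (best_order_cost_le (u := x + u - y) yc _)); first by lra.
    rewrite /order_cost (_ : y + (x + u - y) = x + u); last by ring.
    have : K * (0 < x + u - y)%R%:R <= K * (0 < u)%R%:R.
      by rewrite ler_wpM2l// ler_nat; case: (ltP 0 u) => // ?; case: ltP => //; lra.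
    have : c * (x + u - y) <= c * u by rewrite ler_wpM2l//; lra.
    lra.
  apply: (le_trans (best_order_cost_le (u := 0) yc _)); first by lra.
  rewrite /order_cost ltxx !mulr0 add0r addr0 add0r.
  have : Phi y - Phi (x + u) <= A * (y - (x + u)).
    rewrite -[y - (x + u)]ger0_norm; last by lra.
    by apply: le_trans (ler_norm _) _; apply: Phi_lip; lra.
  have : 0 <= K * (0 < u)%R%:R by rewrite mulr_ge0.
  have : 0 <= c * u by rewrite mulr_ge0//; lra.
  have : A * (y - (x + u)) <= A * (y - x) by rewrite ler_wpM2l//; lra.
  lra.
have key2 : best_order_cost x <= best_order_cost y + (c + A) * (y - x).
  have [/andP[v0 vc] _] := vopt; rewrite (best_order_costE vopt).
  move: v0; rewrite le_eqVlt => /predU1P[v0|v0].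
    apply: (le_trans (best_order_cost_le (u := 0) xc _)); first by lra.
    rewrite -v0 /order_cost ltxx !mulr0 !addr0 !add0r.
    have : Phi x - Phi y <= A * (y - x).
      rewrite -[y - x]ger0_norm ?subr_ge0// (distrC y).
      by apply: le_trans (ler_norm _) _; apply: Phi_lip; lra.
    lra.
  apply: (le_trans (best_order_cost_le (u := y + v - x) xc _)); first by lra.
  rewrite /order_cost (_ : x + (y + v - x) = y + v); last by ring.
  have -> : 0 < y + v - x by lra.
  rewrite v0; lra.
rewrite ler_norml; lra.
Qed.

(** Resetting costs [r x], which is concave and nondecreasing in [x].  Where an
    order is placed, continuing costs [K + c (S - x) + Phi S], which decreases in
    [x]; where none is, it costs the convex [Phi x].  So the points where
    continuing is at least as good as resetting form an interval [[a, b]]. *)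
Lemma reset_thresholds (r : R -> R) (Ar : R) : 0 <= Ar ->
  (forall x y, 0 <= x <= cmax -> 0 <= y <= cmax -> `|r x - r y| <= Ar * `|x - y|) ->
  (forall x y, 0 <= x -> x <= y -> y <= cmax -> r x <= r y) ->
  (forall x y p, 0 <= x <= cmax -> 0 <= y <= cmax -> 0 <= p <= 1 ->
     p * r x + (1 - p) * r y <= r (p * x + (1 - p) * y)) ->
  exists (S : R) (sigma s Sigma : \bar R),
  [/\ 0 <= S <= cmax, [/\ 0 <= sigma, sigma <= s & s <= Sigma]%E
    & forall x,
      [/\ piece cmax 0 sigma x -> r x <= best_order_cost x,
          piece cmax sigma s x ->
            [/\ best_order_cost x <= r x, optimal_order x (S - x) & x < S],
          piece cmax s Sigma x -> best_order_cost x <= r x /\ optimal_order x 0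
        & piece cmax Sigma +oo x -> r x <= best_order_cost x]].
Proof.
move=> Ar0 r_lip r_nd r_concave.
have [s [S [sS Sc lo hi]]] := sS_optimal.
have [[x0 x0c Dx0]|noE] := pselect
  (exists2 x, 0 <= x <= cmax & best_order_cost x - r x <= 0); last first.
  exists S, +oo%E, +oo%E, +oo%E; split; [lra|by rewrite leey|].
  move=> x; split=> -[xc /andP[h1 h2]] //.
  by rewrite leNgt; apply/negP => h; apply: noE; exists x => //; rewrite subr_le0 ltW.
have cAr0 : 0 <= c + A + Ar by rewrite !addr_ge0.
have D_lip x y : 0 <= x <= cmax -> 0 <= y <= cmax ->
    `|(best_order_cost x - r x) - (best_order_cost y - r y)| <= (c + A + Ar) * `|x - y|.
  move=> xc yc.
  rewrite (_ : _ - _ = (best_order_cost x - best_order_cost y) - (r x - r y)); last by ring.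
  apply: le_trans (ler_normB _ _) _; rewrite [leRHS]mulrDl.
  by rewrite lerD ?best_order_cost_lipschitz ?r_lip.
have D_exists : exists2 x, 0 <= x <= cmax & best_order_cost x - r x <= 0 by exists x0.
have [a [ac Da aP]] := lipschitz_first_nonpos cAr0 D_lip D_exists.
have [b [bc Db bP]] := lipschitz_last_nonpos cAr0 D_lip D_exists.
have ab : a <= b by exact: aP.
have best_lo x : 0 <= x -> x < s -> best_order_cost x = c * (S - x) + K + Phi S.
  move=> x_ge0 xs; rewrite (best_order_costE (lo x x_ge0 xs)) /order_cost subrKC.
  have -> : 0 < S - x by lra.
  by rewrite mulr1.
have best_hi x : s <= x -> x <= cmax -> best_order_cost x = Phi x.
  move=> sx xc; rewrite (best_order_costE (hi x sx xc)) /order_cost ltxx.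
  by rewrite !mulr0 !add0r addr0.
have D_lo x : a <= x -> x < s -> best_order_cost x - r x <= 0.
  move=> ax xs; move: Da; rewrite !best_lo; [|lra..].
  have : r a <= r x by apply: r_nd; lra.
  have : c * (S - x) <= c * (S - a) by rewrite ler_wpM2l//; lra.
  lra.
have Ds : a < s -> best_order_cost s - r s <= 0.
  move=> a_s; move: Da; rewrite (best_lo a); [|lra..].
  have : r a <= r s by apply: r_nd; lra.
  have : c * (S - s) <= c * (S - a) by rewrite ler_wpM2l//; lra.
  have : best_order_cost s <= order_cost s (S - s) by apply: best_order_cost_le; lra.
  have : K * (0 < S - s)%R%:R <= K by rewrite ler_piMr// lern1 leq_b1.
  rewrite /order_cost subrKC; lra.
have D_hi x : a <= x -> s <= x -> x <= b -> best_order_cost x - r x <= 0.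
  move=> ax sx xb.
  have [a' [Da' sa' a'x a'c]] : exists a', [/\ best_order_cost a' - r a' <= 0,
      s <= a', a' <= x & 0 <= a' <= cmax].
    by have [sa|a_s] := leP s a; [exists a|exists s; split; [exact: Ds|lra..]].
  have [p p01 xE] := @convex_combination_of_itv _ a' b x (introT andP (conj a'x xb)).
  rewrite best_hi; [|lra..].
  have := Phi_convex a'c bc p01; have := r_concave a' b p a'c bc p01.
  rewrite -xE; move: Da' Db; rewrite !best_hi; [|lra..].
  move: p01 => /andP[p0 p1]; clear xE; nra.
have D_in x : a <= x -> x <= b -> best_order_cost x <= r x.
  by move=> ax xb; rewrite -subr_le0; have [xs|sx] := ltP x s; [exact: D_lo|exact: D_hi].
have D_lt x : 0 <= x <= cmax -> x < a -> r x <= best_order_cost x.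
  move=> xc; apply: contraTT; rewrite -!ltNge -leNgt => h.
  by apply: aP => //; rewrite subr_le0 ltW.
have D_gt x : 0 <= x <= cmax -> b < x -> r x <= best_order_cost x.
  move=> xc; apply: contraTT; rewrite -!ltNge -leNgt => h.
  by apply: bP => //; rewrite subr_le0 ltW.
(* Beyond [b] resetting is better, hence by continuity it is optimal at [b]. *)
have D_b : b < cmax -> r b <= best_order_cost b.
  move=> bc'; rewrite -subr_ge0.
  apply: (@le_of_forall_slack _ _ _ ((c + A + Ar) * (cmax - b))).
    by rewrite mulr_ge0// subr_ge0 ltW.
  move=> e /andP[e0 e1].
  have be : 0 < e * (cmax - b) by rewrite mulr_gt0// subr_gt0.
  have ec : e * (cmax - b) <= cmax - b by rewrite ler_piMl//; lra.
  have bec : 0 <= b + e * (cmax - b) <= cmax by lra.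
  have : r (b + e * (cmax - b)) <= best_order_cost (b + e * (cmax - b)).
    by apply: D_gt => //; rewrite ltrDl.
  have := D_lip _ _ bc bec.
  rewrite (_ : b - (b + e * (cmax - b)) = - (e * (cmax - b))); last by ring.
  rewrite normrN (gtr0_norm be) ler_norml mulrA (mulrAC _ (cmax - b)).
  lra.
(* Where continuing is optimal up to [cmax], there is no upper reset region. *)
exists S, a%:E, (Num.max a s)%:E, (if b < cmax then b%:E else +oo%E); split.
- lra.
- split; rewrite ?lee_fin ?le_max ?lexx//; first by case/andP: ac.
  case: ifPn => _; rewrite ?leey// lee_fin ge_max ab/=.
  have [sa|a_s] := leP s a; first exact: le_trans sa ab.
  by apply: bP (Ds a_s); lra.
- move=> x; split=> -[xc]; rewrite ?lee_fin ?lte_fin.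
  + by move=> /andP[_]; exact: D_lt.
  + rewrite lt_max ltNge => /andP[ax]; rewrite ax/= => xs.
    split; [|apply: lo => //; lra|lra].
    by rewrite -subr_le0; exact: D_lo.
  + rewrite ge_max => /andP[/andP[ax sx] xb]; split; last by apply: hi => //; lra.
    apply: D_in => //; move: xb; case: ifPn; first by rewrite lte_fin => _ /ltW.
    rewrite -leNgt => cb _; lra.
  + case: ifPn => // bc'; rewrite lee_fin => /andP[+ _].
    by rewrite le_eqVlt => /predU1P[<-|]; [exact: D_b|exact: D_gt].
Qed.

End Thresholds.

(** * Convexity of the cost of continuing *)

Section OneStage.
Context {R : realType}.
Implicit Types (x y z p e : R) (V : R -> R).
Variables (mu : probability (measurableTypeR R) R) (f : R -> R) (L Pf : R).
Hypotheses (f0 : forall y, 0 <= f y)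
  (muE : forall B : set (measurableTypeR R), measurable B ->
     mu B = (\int[@lebesgue_measure R]_(y in B) (f y)%:E)%E)
  (f_lt0 : forall y, y < 0 -> f y = 0)
  (L0 : 0 <= L) (f_lip : L.-lipschitz_`[0, +oo[ f)
  (P0 : 0 <= Pf) (fP : forall y, 0 <= y -> `|f y| <= Pf).
Variables (cmax g : R) (h dh ddh : R -> R) (kappa m B : R).
Hypotheses (g0 : 0 <= g) (m0 : 0 < m).
Hypotheses (dhP : forall y, 0 <= y <= cmax -> derive_in `[0, cmax] h y (dh y))
  (ddhP : forall y, 0 <= y <= cmax -> derive_in `[0, cmax] dh y (ddh y))
  (dh_bound : forall y, 0 <= y <= cmax -> `|dh y| <= kappa)
  (ddh_bound : forall y, 0 <= y <= cmax -> m <= ddh y <= B).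
Variables (V : R -> R) (M a : R).
Hypotheses (M0 : 0 <= M) (V_lip : forall x y, `|V x - V y| <= M * `|x - y|)
  (V_bound : forall x, `|V x| <= a) (V_cst : forall z, z <= 0 -> V z = V 0).
Local Notation A := (L * cmax + Pf).
Hypotheses (cmax0 : 0 <= cmax) (A0 : 0 < A) (gM : g * M <= m / A).

Definition continuation mu g (h V : R -> R) y : R := h y + g * mean mu V y.

(** The expected value [mean mu V] need not be convex, but its derivative is
    Lipschitz with constant [A M], and [g A M <= m]: the strong convexity of the
    stage cost [h] makes up for it. *)
Lemma continuation_smooth : exists D, [/\
  forall y, 0 <= y <= cmax -> derive_in `[0, cmax] (continuation mu g h V) y (D y),
  forall y, 0 <= y <= cmax -> `|D y| <= kappa + m / A,
  (exists2 C : R, 0 <= C & forall x y, 0 <= x <= cmax -> 0 <= y <= cmax ->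
     `|D x - D y| <= C * `|x - y|)
  & forall x y, 0 <= x -> x <= y -> y <= cmax -> D x <= D y].
Proof.
have AM0 : 0 <= A * M by rewrite mulr_ge0// ltW.
have [D [DP DM Dlip]] := @increment_lipschitz_derive R cmax (A * M) M (mean mu V)
  AM0 M0 (fun x y _ _ => mean_lipschitz mu V_lip V_bound x y)
  (fun x y e hx hxy he hye => mean_increment f0 muE f_lt0 L0 f_lip P0 fP M0
     V_lip V_bound V_cst hx hxy he hye).
have dh_incr x y : 0 <= x -> x <= y -> y <= cmax ->
    m * (y - x) <= dh y - dh x <= B * (y - x).
  move=> x0 xy yc; apply: (increment_bounds (D := ddh)) => // z zxy; last first.
    by apply: ddh_bound; lra.
  apply: derive_in_sub (ddhP _) => //=; last by lra.
  by move=> t /=; rewrite !in_itv/=; lra.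
have B0 : 0 <= B.
  have /ddh_bound : (0 : R) <= 0 <= cmax by rewrite lexx.
  by move=> /andP[h1 h2]; apply: le_trans h2; apply: le_trans h1; exact: ltW.
have gAM : g * (A * M) <= m.
  by move: gM; rewrite ler_pdivlMr// mulrCA mulrC.
have D_incr x y : 0 <= x -> x <= y -> y <= cmax -> g * `|D y - D x| <= m * (y - x).
  move=> x0 xy yc; have := Dlip y x; rewrite (ger0_norm (_ : 0 <= y - x)) ?subr_ge0//.
  move=> /(_ _ _)/(ler_wpM2l g0) H.
  apply: le_trans (H _ _) _; [lra|lra|].
  by rewrite mulrA ler_wpM2r// subr_ge0.
have up x y : 0 <= x -> x <= y -> y <= cmax ->
    0 <= dh y + g * D y - (dh x + g * D x) <= (B + m) * (y - x).
  move=> x0 xy yc; have := dh_incr x y x0 xy yc; have := D_incr x y x0 xy yc.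
  have : `|g * (D y - D x)| = g * `|D y - D x| by rewrite normrM (ger0_norm g0).
  move=> <-; rewrite ler_norml; lra.
exists (fun y => dh y + g * D y); split.
- by move=> y yc; apply: derive_inD; [exact: dhP|apply: derive_inZ; exact: DP].
- move=> y yc; apply: le_trans (ler_normD _ _) _; rewrite lerD ?dh_bound//.
  rewrite normrM (ger0_norm g0); apply: le_trans gM.
  by rewrite ler_wpM2l// DM.
- exists (B + m); first by rewrite addr_ge0// ltW.
  move=> x y xc yc; have [xy|/ltW yx] := leP x y.
    rewrite distrC (distrC x) (ger0_norm (_ : 0 <= y - x)) ?subr_ge0//.
    by have := up x y; rewrite ler_norml; lra.
  rewrite (ger0_norm (_ : 0 <= x - y)) ?subr_ge0//.
  by have := up y x; rewrite ler_norml; lra.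
- by move=> x y x0 xy yc; have := up x y x0 xy yc; lra.
Qed.

Lemma continuation_convex x y p : 0 <= x <= cmax -> 0 <= y <= cmax ->
  0 <= p <= 1 -> continuation mu g h V (p * x + (1 - p) * y)
    <= p * continuation mu g h V x + (1 - p) * continuation mu g h V y.
Proof.
have [D [DP _ _ Dnd]] := continuation_smooth.
exact: (nondecreasing_derive_convex DP Dnd).
Qed.

End OneStage.

(** * The dynamic programming equations *)

Section DynamicProgram.
Context {R : realType}.
Implicit Types (x y z p e u j : R) (V : R -> R) (t i : nat).
Variables (mu : probability (measurableTypeR R) R) (f : R -> R) (L Pf : R).
Hypotheses (f0 : forall y, 0 <= f y)
  (muE : forall B : set (measurableTypeR R), measurable B ->
     mu B = (\int[@lebesgue_measure R]_(y in B) (f y)%:E)%E)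
  (f_lt0 : forall y, y < 0 -> f y = 0)
  (L0 : 0 <= L) (f_lip : L.-lipschitz_`[0, +oo[ f)
  (P0 : 0 <= Pf) (fP : forall y, 0 <= y -> `|f y| <= Pf).
Variables (k : nat) (cmax g c K : R).
Hypotheses (k0 : (0 < k)%N) (cmax0 : 0 <= cmax) (g0 : 0 <= g) (g1 : g < 1)
  (c0 : 0 <= c) (K0 : 0 <= K).
Variables (H dH ddH : R -> nat -> R) (kappa m : nat -> R).
Hypotheses (kappa0 : forall t, (t < k)%N -> 0 <= kappa t)
  (m0 : forall t, (t < k)%N -> 0 < m t).
Hypotheses (dHP : forall t y, (t < k)%N -> 0 <= y <= cmax ->
    derive_in `[0, cmax] (H ^~ t) y (dH y t))
  (ddHP : forall t y, (t < k)%N -> 0 <= y <= cmax ->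
    derive_in `[0, cmax] (dH ^~ t) y (ddH y t))
  (dH_bound : forall t y, (t < k)%N -> 0 <= y <= cmax -> `|dH y t| <= kappa t)
  (ddH_bound : forall t, (t < k)%N ->
    exists B, forall y, 0 <= y <= cmax -> m t <= ddH y t <= B).
Hypothesis stage_ge0 : forall t x u, (t < k)%N -> 0 <= x -> 0 <= u <= cmax - x ->
  0 <= c * u + K * (0 < u)%R%:R + H (x + u) t.
Variables (r : R -> nat -> R) (eta : nat -> R).
Hypotheses (eta0 : forall t, (t <= k)%N -> 0 <= eta t)
  (r_ge0 : forall t x, (t <= k)%N -> 0 <= x -> 0 <= r x t)
  (r_lip : forall t x y, (t <= k)%N -> 0 <= x <= cmax -> 0 <= y <= cmax ->
     `|r x t - r y t| <= eta t * `|x - y|)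
  (r_nd : forall t x y, (t <= k)%N -> 0 <= x -> x <= y -> r x t <= r y t).
Local Notation A := (L * cmax + Pf).
Hypotheses (A0 : 0 < A)
  (g_last : g * eta k <= m k.-1 / A)
  (g_stage : forall t, (t.+1 < k)%N ->
     g * slope_bound cmax c L Pf kappa m eta t.+1 <= m t / A).

(** Value functions are extended from [[0, cmax]] to the line by clamping.  They
    are then Lipschitz everywhere, and constant before [0], which accounts for
    the positive part in the dynamics. *)
Definition clamp x : R := Num.max 0 (Num.min x cmax).

Lemma clamp_itv x : 0 <= clamp x <= cmax.
Proof. by rewrite /clamp le_max lexx/= ge_max cmax0 ge_min lexx orbT. Qed.

Lemma clamp_id x : 0 <= x <= cmax -> clamp x = x.
Proof. by rewrite /clamp => /andP[x0 xc]; rewrite (min_idPl xc) (max_idPr x0). Qed.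

Lemma clampK x : clamp (clamp x) = clamp x.
Proof. by rewrite clamp_id// clamp_itv. Qed.

Lemma clamp_le0 x : x <= 0 -> clamp x = 0.
Proof.
by move=> x0; apply/max_idPl; rewrite ge_min x0.
Qed.

Lemma clamp_lipschitz x y : `|clamp x - clamp y| <= `|x - y|.
Proof.
wlog xy : x y / x <= y.
  by move=> W; have [/W//|/ltW/W] := leP x y; rewrite distrC (distrC x).
rewrite (distrC x) (ger0_norm (_ : 0 <= y - x)) ?subr_ge0// /clamp.
case: (leP x cmax) => xc; case: (leP y cmax) => yc;
  rewrite ?(min_idPl xc) ?(min_idPr (ltW xc)) ?(min_idPl yc) ?(min_idPr (ltW yc));
  rewrite !maxEle; do ![case: ifPn => ?]; rewrite ler_norml; lra.
Qed.

(** [value_to_go j i] is the optimal value with [i] periods left before the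
    forced reset, when a reset costs [j] beyond its own cost. *)
Fixpoint value_to_go j i : R -> R :=
  if i is i'.+1 then fun x =>
    Num.min (j + r (clamp x) (k - i))
      (best_order_cost cmax c K
         (continuation mu g (H ^~ (k - i)%N) (value_to_go j i')) (clamp x))
  else fun x => j + r (clamp x) k.

(** Lipschitz constant of [value_to_go j i]; at [i = 0] a reset is forced. *)
Definition slope i : R :=
  if i is _.+1 then slope_bound cmax c L Pf kappa m eta (k - i) else eta k.

Lemma slope_ge0 i : (i <= k)%N -> 0 <= slope i.
Proof.
case: i => [|i] ik; first exact: eta0.
have lt : (k - i.+1 < k)%N by rewrite ltn_subrL/= k0.
have : 0 <= m (k - i.+1)%N / A by rewrite divr_ge0 ?ltW ?m0.
rewrite /= /slope_bound.
by have := eta0 (ltnW lt); have := kappa0 lt; have := c0; lra.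
Qed.

Lemma discounted_slope i : (i < k)%N -> g * slope i <= m (k - i.+1)%N / A.
Proof.
case: i => [|i] ik /=; first by rewrite subn1.
have := @g_stage (k - i.+2)%N; rewrite subnSK//; apply.
by rewrite ltn_subrL/= k0.
Qed.

Lemma clamped_lipschitz V M : 0 <= M ->
  (forall x y, 0 <= x <= cmax -> 0 <= y <= cmax -> `|V x - V y| <= M * `|x - y|) ->
  (forall x, V x = V (clamp x)) ->
  [/\ forall x y, `|V x - V y| <= M * `|x - y|,
      forall x, `|V x| <= `|V 0| + M * cmax
    & forall x, x <= 0 -> V x = V 0].
Proof.
move=> M0 Vlip VE.
have lip x y : `|V x - V y| <= M * `|x - y|.
  rewrite (VE x) (VE y); apply: le_trans (Vlip _ _ (clamp_itv x) (clamp_itv y)) _.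
  by rewrite ler_wpM2l// clamp_lipschitz.
split=> // x; last first.
  by move=> x0; rewrite (VE x) clamp_le0.
rewrite -(subrK (V 0) (V x)) addrC; apply: le_trans (ler_normD _ _) _.
rewrite lerD2l VE; apply: le_trans (lip _ _) _; rewrite ler_wpM2l// subr0.
by have /andP[h1 h2] := clamp_itv x; rewrite ger0_norm.
Qed.

Definition stage_continuation t V := continuation mu g (H ^~ t) V.

Section Stage.
Variables (t : nat) (V : R -> R) (M : R).
Hypotheses (tk : (t < k)%N) (M0 : 0 <= M)
  (V_lip : forall x y, `|V x - V y| <= M * `|x - y|)
  (VE : forall x, V x = V (clamp x)) (gM : g * M <= m t / A).

Let V_bound : forall x, `|V x| <= `|V 0| + M * cmax.
Proof. by have [] := clamped_lipschitz M0 (fun x y _ _ => V_lip x y) VE. Qed.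

Let V_cst : forall x, x <= 0 -> V x = V 0.
Proof. by have [] := clamped_lipschitz M0 (fun x y _ _ => V_lip x y) VE. Qed.

Lemma stage_smooth : exists D, [/\
  forall y, 0 <= y <= cmax -> derive_in `[0, cmax] (stage_continuation t V) y (D y),
  forall y, 0 <= y <= cmax -> `|D y| <= kappa t + m t / A
  & exists2 C : R, 0 <= C & forall x y, 0 <= x <= cmax -> 0 <= y <= cmax ->
     `|D x - D y| <= C * `|x - y|].
Proof.
have [B Bb] := ddH_bound tk.
have [D [D1 D2 D3 _]] := continuation_smooth f0 muE f_lt0 L0 f_lip P0 fP g0 (m0 tk)
  (fun y => @dHP t y tk) (fun y => @ddHP t y tk) (fun y => @dH_bound t y tk)
  Bb M0 V_lip V_bound V_cst cmax0 A0 gM.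
by exists D.
Qed.

Lemma stage_lipschitz x y : 0 <= x <= cmax -> 0 <= y <= cmax ->
  `|stage_continuation t V x - stage_continuation t V y|
    <= (kappa t + m t / A) * `|x - y|.
Proof.
have [D [DP DM _]] := stage_smooth.
exact: (derive_in_lipschitz DP DM).
Qed.

Lemma stage_convex x y p : 0 <= x <= cmax -> 0 <= y <= cmax ->
  0 <= p <= 1 -> stage_continuation t V (p * x + (1 - p) * y)
    <= p * stage_continuation t V x + (1 - p) * stage_continuation t V y.
Proof.
have [B Bb] := ddH_bound tk.
exact: (continuation_convex f0 muE f_lt0 L0 f_lip P0 fP g0 (m0 tk)
  (fun y => @dHP t y tk) (fun y => @ddHP t y tk) (fun y => @dH_bound t y tk)
  Bb M0 V_lip V_bound V_cst cmax0 A0 gM).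
Qed.

End Stage.

Definition regular M V := [/\ forall x y, `|V x - V y| <= M * `|x - y|,
  forall x, V x = V (clamp x) & forall x, 0 <= V x].

Lemma min_lipschitz (u u' v v' e : R) : `|u - u'| <= e -> `|v - v'| <= e ->
  `|Num.min u v - Num.min u' v'| <= e.
Proof.
rewrite !minEle !ler_norml; do 2 case: ifPn; rewrite -?ltNge; lra.
Qed.

Lemma continuation_slope_ge0 t : (t < k)%N -> 0 <= kappa t + m t / A.
Proof. by move=> tk; rewrite addr_ge0 ?kappa0// divr_ge0 ?ltW// m0. Qed.

(** The discount bound turns the slope of the value function of a stage into the
    convexity of the cost of continuing one stage earlier, and hence into the
    slope of the value function there. *)
Lemma value_to_go_regular j i : 0 <= j -> (i <= k)%N ->
  regular (slope i) (value_to_go j i).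
Proof.
move=> j0; elim: i => [|i IH] ik.
  split=> /= [x y|x|x].
  - rewrite (_ : _ - _ = r (clamp x) k - r (clamp y) k); last by ring.
    apply: le_trans (r_lip _ (clamp_itv x) (clamp_itv y)) _ => //.
    by rewrite ler_wpM2l ?eta0// clamp_lipschitz.
  - by rewrite clampK.
  - by rewrite addr_ge0// r_ge0//; case/andP: (clamp_itv x).
have [V_lip VE V_ge0] := IH (ltnW ik).
have tk : (k - i.+1 < k)%N by rewrite ltn_subrL/= k0.
have gM := discounted_slope ik.
have M0 := slope_ge0 (ltnW ik).
set V := value_to_go j i in V_lip VE V_ge0 *.
set t := (k - i.+1)%N in tk gM *.
have Plip := stage_lipschitz tk M0 V_lip VE gM.
have Pcvx := stage_convex tk M0 V_lip VE gM.
have kA := continuation_slope_ge0 tk.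
split=> [x y|x|x].
- rewrite [value_to_go _ _ x]/= [value_to_go _ _ y]/= -/V -/t.
  have rl : `|(j + r (clamp x) t) - (j + r (clamp y) t)| <= slope i.+1 * `|x - y|.
    rewrite (_ : _ - _ = r (clamp x) t - r (clamp y) t); last by ring.
    apply: le_trans (r_lip (ltnW tk) (clamp_itv x) (clamp_itv y)) _.
    apply: ler_pM => //; [exact: eta0 (ltnW tk)| |exact: clamp_lipschitz].
    rewrite /= -/t /slope_bound; move: kA; have := c0; lra.
  apply: min_lipschitz => //.
  apply: le_trans (best_order_cost_lipschitz cmax0 c0 K0 kA Plip Pcvx
    (clamp_itv x) (clamp_itv y)) _.
  apply: ler_pM => //; [by rewrite addr_ge0| |exact: clamp_lipschitz].
  rewrite /= -/t /slope_bound; have := eta0 (ltnW tk); lra.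
- by rewrite [LHS]/= [RHS]/= clampK.
- rewrite [value_to_go _ _ x]/= -/V -/t le_min addr_ge0//=; last first.
    by rewrite r_ge0// ?(ltnW tk)//; case/andP: (clamp_itv x).
  have [u [uc umin]] := optimal_order_exists cmax0 c0 K0 kA Plip Pcvx (clamp_itv x).
  rewrite (best_order_costE (conj uc umin)) /order_cost addrA addr_ge0//.
    have /andP[x0 _] := clamp_itv x.
    exact: stage_ge0.
  by rewrite mulr_ge0// Rintegral_ge0.
Qed.

Lemma mean_le V V' M M' y : 0 <= M -> 0 <= M' -> regular M V -> regular M' V' ->
  (forall x, V x <= V' x) -> mean mu V y <= mean mu V' y.
Proof.
move=> M_ge0 M'0 [V_lip VE _] [V'_lip V'E _] VV'.
have [_ Vb _] := clamped_lipschitz M_ge0 (fun x y _ _ => V_lip x y) VE.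
have [_ V'b _] := clamped_lipschitz M'0 (fun x y _ _ => V'_lip x y) V'E.
apply: le_Rintegral => //.
  exact: (mean_integrable mu V_lip Vb).
exact: (mean_integrable mu V'_lip V'b).
Qed.

Lemma best_order_cost_mono t V V' M M' x : (t < k)%N -> 0 <= M -> 0 <= M' ->
  regular M V -> regular M' V' -> g * M <= m t / A -> g * M' <= m t / A ->
  (forall z, V z <= V' z) -> 0 <= x <= cmax ->
  best_order_cost cmax c K (stage_continuation t V) x
    <= best_order_cost cmax c K (stage_continuation t V') x.
Proof.
move=> tk M_ge0 M'0 rV rV' gM gM' VV' xc.
have kA := continuation_slope_ge0 tk.
have [V_lip VE _] := rV; have [V'_lip V'E _] := rV'.
have Plip := stage_lipschitz tk M_ge0 V_lip VE gM.
have Pcvx := stage_convex tk M_ge0 V_lip VE gM.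
have Plip' := stage_lipschitz tk M'0 V'_lip V'E gM'.
have Pcvx' := stage_convex tk M'0 V'_lip V'E gM'.
have [u [uc umin]] := optimal_order_exists cmax0 c0 K0 kA Plip' Pcvx' xc.
rewrite (best_order_costE (conj uc umin)).
apply: le_trans (best_order_cost_le cmax0 c0 K0 kA Plip Pcvx xc uc) _.
rewrite lerD2l lerD2l ler_wpM2l//.
exact: mean_le rV rV' VV'.
Qed.

Lemma value_to_go_mono j j' i x : 0 <= j -> j <= j' -> (i <= k)%N ->
  value_to_go j i x <= value_to_go j' i x.
Proof.
move=> j0 jj'; elim: i x => [|i IH] x ik; first by rewrite /= lerD2r.
have j'0 := le_trans j0 jj'.
have tk : (k - i.+1 < k)%N by rewrite ltn_subrL/= k0.
rewrite [value_to_go j _ x]/= [value_to_go j' _ x]/=.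
have h1 : j + r (clamp x) (k - i.+1) <= j' + r (clamp x) (k - i.+1) by rewrite lerD2r.
have h2 := best_order_cost_mono tk (slope_ge0 (ltnW ik)) (slope_ge0 (ltnW ik))
  (value_to_go_regular j0 (ltnW ik)) (value_to_go_regular j'0 (ltnW ik))
  (discounted_slope ik) (discounted_slope ik) (fun z => IH z (ltnW ik)) (clamp_itv x).
rewrite le_min; apply/andP; split; rewrite ge_min ?h1//.
by apply/orP; right; exact: h2.
Qed.

Lemma value_to_go_le j i x : (i <= k)%N ->
  value_to_go j i x <= j + r cmax (k - i)%N.
Proof.
have /andP[x0 xc] := clamp_itv x.
case: i => [|i] ik /=; first by rewrite subn0 lerD2l r_nd.
by rewrite ge_min lerD2l r_nd ?leq_subr.
Qed.

(** The value [j] of the state just after a reset is a fixed point of the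
    monotone map that computes this value from itself.  Since the map grows at
    most like [g j] with [g < 1], it has a largest subsolution, which is a
    fixed point. *)
Lemma reset_value_exists : exists2 j, 0 <= j &
  j = best_order_cost cmax c K (stage_continuation 0 (value_to_go j k.-1)) 0.
Proof.
pose F j := best_order_cost cmax c K (stage_continuation 0 (value_to_go j k.-1)) 0.
have k1k : (k.-1 < k)%N by rewrite prednK.
have gM := discounted_slope k1k; rewrite prednK// subnn in gM.
have M_ge0 := slope_ge0 (ltnW k1k).
have cmax00 : (0 : R) <= 0 <= cmax by rewrite lexx.
have kA := continuation_slope_ge0 k0.
have F_mono j j' : 0 <= j -> j <= j' -> F j <= F j'.
  move=> j0 jj'; have j'0 := le_trans j0 jj'.
  apply: (best_order_cost_mono k0 M_ge0 M_ge0) => //.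
  - exact: value_to_go_regular (ltnW k1k).
  - exact: value_to_go_regular (ltnW k1k).
  - by move=> z; apply: value_to_go_mono => //; exact: ltnW.
have F_opt j : 0 <= j -> exists2 u, 0 <= u <= cmax - 0 &
    F j = order_cost c K (stage_continuation 0 (value_to_go j k.-1)) 0 u /\
    forall v, 0 <= v <= cmax - 0 ->
      F j <= order_cost c K (stage_continuation 0 (value_to_go j k.-1)) 0 v.
  move=> j0; have [V_lip VE V_ge0] := value_to_go_regular j0 (ltnW k1k).
  have Plip := stage_lipschitz k0 M_ge0 V_lip VE gM.
  have Pcvx := stage_convex k0 M_ge0 V_lip VE gM.
  have [u [uc umin]] := optimal_order_exists cmax0 c0 K0 kA Plip Pcvx cmax00.
  by exists u => //; rewrite /F (best_order_costE (conj uc umin)); split.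
have F_ge0 j : 0 <= j -> 0 <= F j.
  move=> j0; have [_ _ V_ge0] := value_to_go_regular j0 (ltnW k1k).
  have [u uc [-> _]] := F_opt j j0; rewrite /order_cost addrA addr_ge0//.
    exact: stage_ge0.
  by rewrite mulr_ge0// Rintegral_ge0.
pose E := [set j | 0 <= j /\ j <= F j].
pose b := (H 0 0 + g * r cmax 1) / (1 - g).
have E_ub : ubound E b.
  move=> j [j0 jF].
  have [_ _ [_ /(_ 0)]] := F_opt j j0.
  rewrite lexx subr0 => /(_ cmax0)/(le_trans jF).
  rewrite /order_cost ltxx !mulr0 !add0r => h.
  have rV := value_to_go_regular j0 (ltnW k1k).
  have mb : mean mu (value_to_go j k.-1) 0 <= j + r cmax 1.
    have rc : regular 0 (cst (j + r cmax 1)).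
      split=> //=; first by move=> *; rewrite subrr normr0 mul0r.
      by move=> _; rewrite addr_ge0// r_ge0.
    have := @mean_le _ _ _ 0 0 M_ge0 _ rV rc.
    rewrite {2}/mean Rintegral_cst// [X in _ * fine X](_ : _ = 1%E) ?mulr1;
      last exact: probability_setT.
    apply=> // x; have := value_to_go_le j x (ltnW k1k).
    by rewrite -subn1 subKn.
  rewrite /b ler_pdivlMr ?subr_gt0//.
  move: h; rewrite /stage_continuation /continuation.
  have := ler_wpM2l g0 mb; lra.
have E_sup : has_sup E by split; [exists 0; split=> //; exact: F_ge0|exists b].
have supP j : E j -> j <= sup E by move=> Ej; apply: ub_le_sup => //; exists b.
have sup0 : 0 <= sup E by apply: supP; split => //; exact: F_ge0.
have supF : sup E <= F (sup E).
  apply: ge_sup; first by exists 0; split => //; exact: F_ge0.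
  by move=> j Ej; have [j0 jF] := Ej; apply: le_trans jF _; apply: F_mono => //; exact: supP.
exists (sup E) => //; apply/eqP; rewrite eq_le supF/=; apply: supP.
by split; [exact: F_ge0|apply: F_mono].
Qed.

(** Solution of the dynamic programming equations; [V t] is the value function
    of the states with clock [t], extended by clamping outside [[0, cmax]]. *)
Lemma dynamic_program_solution : exists j (V : nat -> R -> R), [/\ 0 <= j,
  forall t, (t <= k)%N -> exists2 M, 0 <= M & regular M (V t),
  forall x, V k x = j + r (clamp x) k,
  forall t, (t < k)%N ->
    (exists M, [/\ 0 <= M, g * M <= m t / A & regular M (V t.+1)]) /\
    forall x, 0 <= x <= cmax -> V t x = Num.min (j + r x t)
      (best_order_cost cmax c K (stage_continuation t (V t.+1)) x)
  & j = best_order_cost cmax c K (stage_continuation 0 (V 1%N)) 0].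
Proof.
have [j j0 jE] := reset_value_exists.
exists j, (fun t => value_to_go j (k - t)); split=> //.
- move=> t tk; exists (slope (k - t)); first by rewrite slope_ge0 ?leq_subr.
  by apply: value_to_go_regular; rewrite ?leq_subr.
- by move=> x; rewrite subnn.
- move=> t tk; split.
    have ktk : (k - t.+1 < k)%N by rewrite ltn_subrL/= k0.
    exists (slope (k - t.+1)); split.
    + exact: slope_ge0 (ltnW ktk).
    + by have := discounted_slope ktk; rewrite subnSK// subKn// ltnW.
    + exact: value_to_go_regular (ltnW ktk).
  move=> x xc; rewrite -(subnSK tk) [LHS]/= clamp_id//.
  by rewrite subnSK// subKn// ltnW.
- by rewrite subn1.
Qed.

End DynamicProgram.

(** * Measurability by discretisation *)

Section Discretisation.
Context {R : realType}.
Implicit Types (x y z : R).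

Lemma measurable_countable_factor d (X : measurableType d) (I : countType)
    (phi : X -> I) (G : I -> R) : (forall i, measurable (phi @^-1` [set i])) ->
  measurable_fun setT (G \o phi).
Proof.
move=> mphi _ B mB; rewrite setTI.
have -> : (G \o phi) @^-1` B =
    \bigcup_n (if unpickle n is Some i then
                 if G i \in B then phi @^-1` [set i] else set0 else set0).
  apply/seteqP; split=> [x /= Bx|x [n _]].
    by exists (pickle (phi x)) => //; rewrite pickleK mem_set.
  by case: unpickle => // i; case: ifPn => //; rewrite inE => Bi /= ->.
apply: bigcupT_measurable => n; case: unpickle => // i; case: ifPn => // _; exact: mphi.
Qed.

(** Rounding down to a multiple of [1 / (N + 1)]. *)
Definition grid (N : nat) x : R := (Num.floor (N.+1%:R * x))%:~R / N.+1%:R.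

Lemma grid0 N : grid N 0 = 0.
Proof. by rewrite /grid mulr0 floor0 mul0r. Qed.

Lemma grid_cvg x : grid N x @[N --> \oo] --> x.
Proof.
apply/cvgrPdist_le => e e0; near=> N.
have N0 : 0 < N.+1%:R :> R by [].
have /andP[h1 h2] := floor_itv (N.+1%:R * x).
rewrite intrD in h2.
have -> : x - grid N x = (N.+1%:R * x - (Num.floor (N.+1%:R * x))%:~R) / N.+1%:R.
  by rewrite /grid; field; rewrite gt_eqF.
rewrite ger0_norm; last by rewrite divr_ge0// subr_ge0.
apply: (@le_trans _ _ N.+1%:R^-1).
  rewrite -[leRHS]mul1r ler_wpM2r// lerBlDl; exact: ltW.
by apply: ltW; near: N; exact: near_infty_natSinv_lt (PosNum e0).
Unshelve. all: by end_near. Qed.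

Lemma measurable_grid_fiber d (X : measurableType d) (a : X -> R) N (z : int) :
  measurable_fun setT a ->
  measurable ((fun om => Num.floor (N.+1%:R * a om)) @^-1` [set z]).
Proof.
move=> ma.
have -> : (fun om => Num.floor (N.+1%:R * a om)) @^-1` [set z] =
    a @^-1` `[z%:~R / N.+1%:R, (z + 1)%:~R / N.+1%:R[.
  apply/seteqP; split=> om /=; rewrite in_itv/= ler_pdivrMr// ltr_pdivlMr//
    ![a om * _]mulrC -floor_eq; first by move=> ->.
  by move/eqP.
by rewrite -[_ @^-1` _]setTI; exact: ma.
Qed.

(** Measurability of functions of real and integer random variables whose
    values on the grid points converge.  A function that is continuous on
    [u = 0] and at every point with [u != 0] qualifies, since rounding
    preserves [u = 0]. *)
Lemma measurable_grid_limit (G : R -> R -> R -> nat -> R) :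
  (forall x u v t, G (grid N x) (grid N u) (grid N v) t @[N --> \oo] --> G x u v t) ->
  forall d (X : measurableType d) (a b c : X -> R) (t : X -> nat),
  measurable_fun setT a -> measurable_fun setT b -> measurable_fun setT c ->
  measurable_fun setT t ->
  measurable_fun setT (fun om => G (a om) (b om) (c om) (t om)).
Proof.
move=> G_cvg d X a b c t ma mb mc mt.
apply: (@measurable_fun_cvg _ _ _ _
  (fun N om => G (grid N (a om)) (grid N (b om)) (grid N (c om)) (t om))).
  move=> N.
  pose fl (y : X -> R) om := Num.floor (N.+1%:R * y om).
  pose phi om := (fl a om, fl b om, fl c om, t om).
  pose q (z : int) : R := z%:~R / N.+1%:R.
  apply: (@measurable_countable_factor _ _ _ phi
    (fun i => G (q i.1.1.1) (q i.1.1.2) (q i.1.2) i.2)).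
  move=> [[[i1 i2] i3] i4].
  have -> : phi @^-1` [set (i1, i2, i3, i4)] =
    fl a @^-1` [set i1] `&` fl b @^-1` [set i2] `&` fl c @^-1` [set i3] `&`
    t @^-1` [set i4].
    by apply/seteqP; split=> om /=; [by case=> <- <- <- <-|by case=> [[[<- <-] <-] <-]].
  apply: measurableI; last by rewrite -[_ @^-1` _]setTI; exact: mt.
  by do 2 ?apply: measurableI; exact: measurable_grid_fiber.
by move=> om _; exact: G_cvg.
Qed.

End Discretisation.

(** * Independence of the past *)

Section Past.
Context {R : realType} {d : measure_display} {T : measurableType d}
  {P : probability T R}.
Variable w : nat -> {RV P >-> R}.
Hypothesis w_indep : independent_seq w.
Hypothesis w_ident : forall n (B : set R), measurable B ->
  distribution P (w n) B = distribution P (w 0%N) B.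

Definition past_gen n : set (set T) :=
  \bigcup_(i in `I_n) preimage_set_system setT (w i) measurable.

Definition pastType n : measurableType (past_gen n).-sigma :=
  g_sigma_algebraType (past_gen n).

Lemma past_sub_measurable n (A : set T) : past w n A -> measurable A.
Proof.
move: A; apply: smallest_sub; first exact: sigma_algebra_measurable.
by move=> _ [i _ [B mB <-]]; exact: measurable_funPT.
Qed.

Lemma past_sub n n' (A : set T) : (n <= n')%N -> past w n A -> past w n' A.
Proof.
move=> nn'; move: A; apply: smallest_sub; first exact: smallest_sigma_algebra.
move=> E [i /= ltin wE]; apply: sub_sigma_algebra.
by exists i => //=; exact: leq_trans ltin nn'.
Qed.

Lemma measurable_past_noise n i : (i < n)%N ->
  measurable_fun [set: pastType n] (w i : _ -> R).
Proof.
move=> ltin _ B mB; rewrite setTI; apply: sub_sigma_algebra.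
by exists i => //; exists B => //; rewrite setTI.
Qed.

Lemma measurable_past d' (Y : measurableType d') n (X : T -> Y) :
  measurable_fun [set: pastType n] X -> measurable_fun [set: T] X.
Proof.
by move=> mX _ B mB; apply: (@past_sub_measurable n); exact: mX.
Qed.

Lemma measurable_past_le d' (Y : measurableType d') n n' (X : T -> Y) :
  (n <= n')%N ->
  measurable_fun [set: pastType n] X -> measurable_fun [set: pastType n'] X.
Proof. by move=> nn' mX _ B mB; apply: (past_sub nn'); exact: mX. Qed.

Definition cylinder n : set (set T) :=
  [set A | exists B : nat -> set R, (forall i, measurable (B i)) /\
     A = \bigcap_(i in `I_n) (w i @^-1` B i)].

Lemma past_cylinder n : past w n = <<s cylinder n >>.
Proof.
apply/seteqP; split.
  apply: smallest_sub; first exact: smallest_sigma_algebra.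
  move=> _ [i /= ltin [B mB <-]]; apply: sub_sigma_algebra.
  exists (fun j => if j == i then B else setT); split.
    by move=> j; case: ifP.
  rewrite setTI; apply/seteqP; split=> om /=.
    by move=> wB j _ /=; case: eqP => [->|].
  by move=> /(_ i ltin) /=; rewrite eqxx.
apply: smallest_sub; first exact: smallest_sigma_algebra.
move=> _ [B [mB ->]].
suff : (past_gen n).-sigma.-measurable (\bigcap_(i in `I_n) (w i @^-1` B i)) by [].
apply: bigcap_measurableType => i ltin.
by rewrite -[X in measurable X]setTI; exact: measurable_past_noise.
Qed.

(** The past up to time [n] is independent of the [n]-th disturbance: both
    sides are finite measures of [A], and they agree on the cylinders, which
    are stable under intersection. *)
Lemma past_independent n (A : set T) (B : set R) : past w n A -> measurable B ->
  P (A `&` w n @^-1` B) = (P A * P (w n @^-1` B))%E.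
Proof.
move=> pA mB.
have mC : measurable (w n @^-1` B).
  by rewrite -[X in measurable X]setTI; exact: (measurable_funP (w n)).
have mid : measurable_fun [set: T] (id : T -> pastType n).
  by move=> _ E pE; rewrite setTI; exact: past_sub_measurable pE.
pose id_mixin := isMeasurableFun.Build _ _ _ _ _ mid.
pose idp : {mfun T >-> pastType n} := HB.pack (id : T -> pastType n) id_mixin.
have PC0 : 0 <= fine (P (w n @^-1` B)) by rewrite fine_ge0.
pose q : {nonneg R} := NngNum PC0.
have qE : q%:num%:E = P (w n @^-1` B) by rewrite /= fineK// fin_num_measure.
have [m1 m1E] : exists m1 : {measure set (pastType n) -> \bar R},
    forall E, m1 E = P (E `&` w n @^-1` B).
  by exists (@measure_function_pushforward__canonical__measure_function_Measure
    _ _ _ _ _ (mrestr P mC) _ mid).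
have [m2 m2E] : exists m2 : {measure set (pastType n) -> \bar R},
    forall E, m2 E = (P (w n @^-1` B) * P E)%E.
  by exists (mscale q (distribution P idp)) => E; rewrite -qE.
rewrite muleC -m1E -m2E.
apply: (@measure_unique _ _ (pastType n) (cylinder n) (fun=> setT) _ _ _ _ m1 m2) => //.
- exact: past_cylinder.
- move=> _ _ [B1 [mB1 ->]] [B2 [mB2 ->]].
  exists (fun i => B1 i `&` B2 i); split; first by move=> i; exact: measurableI.
  apply/seteqP; split=> om /=.
    by move=> [h1 h2] i ltin; split; [exact: h1|exact: h2].
  by move=> h; split=> i ltin; have [] := h i ltin.
- move=> _; exists (fun=> setT); split => //.
  by apply/seteqP; split.
- by apply/seteqP; split => // om _; exists 0%N.
- move=> E [B1 [mB1 ->]].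
  rewrite m1E m2E.
  have /= hn := w_indep n mB1.
  pose B2 i := if i == n then B else B1 i.
  have mB2 i : measurable (B2 i) by rewrite /B2; case: ifP.
  have /= hS := w_indep n.+1 mB2.
  rewrite big_ord_recr/= /B2 eqxx in hS.
  rewrite muleC [X in (X * _)%E]hn.
  rewrite (eq_bigr (fun i : 'I_n => P (w i @^-1` B1 i))) in hS; last first.
    by move=> i _; rewrite ltn_eqF.
  rewrite -hS; congr (P _); apply/seteqP; split=> om /=.
    move=> [h1 h2] i /=; rewrite ltnS leq_eqVlt => /predU1P[->|ltin].
      by rewrite eqxx.
    by rewrite ltn_eqF//; exact: h1.
  move=> h; split; last by have := h n (ltnSn n); rewrite /= eqxx.
  by move=> i /= ltin; have := h i (ltnW ltin); rewrite /= ltn_eqF.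
- move=> _; rewrite m1E.
  apply: (le_lt_trans (probability_le1 _ _)) => //; last exact: ltry.
  by apply: measurableI.
Qed.

(** Freezing: the state and the control at time [n] are constants for the
    conditional law of the disturbance [w n]. *)
Lemma freezing n (F : pastType n * R -> \bar R) :
  measurable_fun setT F -> (forall x, (0 <= F x)%E) ->
  (\int[P]_om F (om, w n om) =
   \int[P]_om \int[distribution P (w 0%N)]_v F (om, v))%E.
Proof.
move=> mF F0.
have mid : measurable_fun [set: T] (id : T -> pastType n).
  by move=> _ E pE; rewrite setTI; exact: past_sub_measurable pE.
pose id_mixin := isMeasurableFun.Build _ _ _ _ _ mid.
pose idp : {mfun T >-> pastType n} := HB.pack (id : T -> pastType n) id_mixin.
have mjoint : measurable_fun [set: T] (fun om => (idp om, w n om)).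
  exact: measurable_fun_pair.
pose j_mixin := isMeasurableFun.Build _ _ _ _ _ mjoint.
pose joint : {mfun T >-> (pastType n * R)%type} :=
  HB.pack (fun om => (idp om, w n om)) j_mixin.
rewrite -[LHS](@ge0_integral_distribution _ _ _ _ _ P joint F)//.
rewrite (eq_measure_integral (distribution P idp \x distribution P (w 0%N))%E); last first.
  move=> A mA _; apply/esym; apply: product_measure_unique => //.
  move=> A1 B1 mA1 mB1 /=.
  rewrite -(w_ident n mB1) /distribution /pushforward /=.
  by rewrite -past_independent.
rewrite [LHS]fubini_tonelli1//.
have := @ge0_integral_distribution _ _ _ _ _ P idp (fubini_F (distribution P (w 0%N)) F).
apply; first exact: measurable_fun_fubini_tonelli_F.
by move=> y; exact: integral_ge0.
Qed.

End Past.

(** * Verification *)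

Section Verification.
Context {R : realType} {d : measure_display} {T : measurableType d}
  {P : probability T R}.
Variables (w : nat -> {RV P >-> R}) (pb : problem R) (cmax : R).
Hypothesis w_indep : independent_seq w.
Hypothesis w_ident : forall n (B : set R), measurable B ->
  distribution P (w n) B = distribution P (w 0%N) B.
Hypothesis w_ge0 : forall n, {ae P, forall om, 0 <= w n om}.
Hypotheses (standing : standing_assumptions pb) (dyn : A1 pb)
  (reset0 : reset_state pb = 0) (adm : A4 pb cmax).
Hypothesis discount01 : 0 <= discount pb < 1.
Local Notation g := (discount pb).
Local Notation k := (period pb).

Lemma measurable_nat_of_bool d' (X : measurableType d') (b : X -> bool) :
  measurable_fun setT b -> measurable_fun setT (fun om => (b om)%:R : R).
Proof.
move=> mb; have -> : (fun om => (b om)%:R : R) = fun om => if b om then 1 else 0.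
  by apply/funext => om; case: (b om).
exact: measurable_fun_ifT.
Qed.

Lemma measurable_after_reset d' (X : measurableType d') (z : X -> R * nat)
    (b : X -> bool) : measurable_fun setT z -> measurable_fun setT b ->
  measurable_fun setT (fun om => after_reset pb (z om) (b om)).
Proof. by move=> mz mb; apply: measurable_fun_ifT. Qed.

Lemma measurable_stage_cost d' (X : measurableType d') (x u v : X -> R)
    (t : X -> nat) :
  measurable_fun setT x -> measurable_fun setT u -> measurable_fun setT v ->
  measurable_fun setT t ->
  measurable_fun setT (fun om => stage_cost pb (x om) (t om) (u om) (v om)).
Proof.
move=> mx mu mv mt; have [_ _ stage_cont _ _] := standing.
have stage_cvg y q v0 t0 : stage_cost pb (grid N y) t0 (grid N q) (grid N v0)
    @[N --> \oo] --> stage_cost pb y t0 q v0.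
  have [cont1 cont0] := stage_cont t0.
  have [->|q0] := eqVneq q 0.
    under eq_fun do rewrite grid0.
    apply: (cvg_comp (fun N => (grid N y, grid N v0))
      (fun q : R * R => stage_cost pb q.1 t0 0 q.2) _ (cont0 (y, v0))).
    exact: (cvg_pair (grid_cvg (x := y)) (grid_cvg (x := v0))).
  apply: (cvg_comp (fun N => (grid N y, grid N q, grid N v0))
    (fun q : R * R * R => stage_cost pb q.1.1 t0 q.1.2 q.2) _ (cont1 (y, q, v0) q0)).
  exact: (cvg_pair (cvg_pair (grid_cvg (x := y)) (grid_cvg (x := q)))
    (grid_cvg (x := v0))).
exact: (measurable_grid_limit stage_cvg mx mu mv mt).
Qed.

Lemma measurable_reset_cost d' (X : measurableType d') (x v : X -> R)
    (t : X -> nat) :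
  measurable_fun setT x -> measurable_fun setT v -> measurable_fun setT t ->
  measurable_fun setT (fun om => reset_cost pb (x om) (t om) (v om)).
Proof.
move=> mx mv mt; have [_ _ _ _ reset_cont] := standing.
have reset_cvg (y q v0 : R) t0 : reset_cost pb (grid N y) t0 (grid N v0)
    @[N --> \oo] --> reset_cost pb y t0 v0.
  have [cont _] := reset_cont t0.
  apply: (cvg_comp (fun N => (grid N y, grid N v0))
    (fun q : R * R => reset_cost pb q.1 t0 q.2) _ (cont (y, v0))).
  exact: (cvg_pair (grid_cvg (x := y)) (grid_cvg (x := v0))).
exact: (measurable_grid_limit reset_cvg mx mv mv mt).
Qed.

Lemma measurable_step_cost d' (X : measurableType d') (z : X -> R * nat)
    (a : X -> bool * R) (v : X -> R) :
  measurable_fun setT z -> measurable_fun setT a -> measurable_fun setT v ->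
  measurable_fun setT (fun om => step_cost pb (z om) (a om) (v om)).
Proof.
move=> mz ma mv.
have ma1 := measurableT_comp (@measurable_fst _ _ _ _) ma.
have ma2 := measurableT_comp (@measurable_snd _ _ _ _) ma.
have mz1 := measurableT_comp (@measurable_fst _ _ _ _) mz.
have mz2 := measurableT_comp (@measurable_snd _ _ _ _) mz.
have mp := measurable_after_reset mz ma1.
have mp1 := measurableT_comp (@measurable_fst _ _ _ _) mp.
have mp2 := measurableT_comp (@measurable_snd _ _ _ _) mp.
apply: measurable_funD; first exact: (measurable_stage_cost mp1 ma2 mv mp2).
apply: measurable_funM; last exact: measurable_nat_of_bool.
exact: (measurable_reset_cost mz1 mv mz2).
Qed.

Lemma measurable_step d' (X : measurableType d') (z : X -> R * nat)
    (a : X -> bool * R) (v : X -> R) :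
  measurable_fun setT z -> measurable_fun setT a -> measurable_fun setT v ->
  measurable_fun setT (fun om => step pb (z om) (a om) (v om)).
Proof.
move=> mz ma mv.
have ma1 := measurableT_comp (@measurable_fst _ _ _ _) ma.
have ma2 := measurableT_comp (@measurable_snd _ _ _ _) ma.
have mp := measurable_after_reset mz ma1.
have mp1 := measurableT_comp (@measurable_fst _ _ _ _) mp.
have mp2 := measurableT_comp (@measurable_snd _ _ _ _) mp.
apply: measurable_fun_pair.
  under eq_fun do rewrite dyn.
  apply: measurable_maxr => //.
  by apply: measurable_funB => //; exact: measurable_funD.
exact: (measurableT_comp (f := S) _ mp2).
Qed.

Lemma measurable_control a n : nonanticipative w a ->
  measurable_fun [set: pastType w n] (a n).
Proof.
move=> /(_ n)[pb1 pb2].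
rewrite (_ : a n = fun om => ((a n om).1, (a n om).2)); last first.
  by apply/funext => om; case: (a n om).
apply: measurable_fun_pair.
  apply: measurable_fun_bool true _.
  by rewrite setTI.
by move=> _ B mB; rewrite setTI; exact: pb2.
Qed.

Lemma measurable_state z a n : nonanticipative w a ->
  measurable_fun [set: pastType w n] (state pb w z a n).
Proof.
move=> na; elim: n => [|n IH]; first exact: measurable_cst.
apply: measurable_step.
- exact: (measurable_past_le (leqnSn n) IH).
- exact: (measurable_past_le (leqnSn n) (measurable_control na)).
- exact: measurable_past_noise.
Qed.

Lemma state_closed_loop pi z n om :
  state pb w z (closed_loop pb w pi z) n om = closed_loop_state pb w pi z n om.
Proof. by elim: n => //= n ->. Qed.

Lemma closed_loop_nonanticipative (pi : policy) z :
  measurable_fun setT (fun y : R * nat => pi y.1 y.2) ->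
  nonanticipative w (closed_loop pb w pi z).
Proof.
move=> mpi.
have mstate n : measurable_fun [set: pastType w n] (closed_loop_state pb w pi z n).
  elim: n => [|n IH]; first exact: measurable_cst.
  have IH' := measurable_past_le (leqnSn n) IH.
  apply: measurable_step => //; first exact: (measurableT_comp mpi IH').
  exact: measurable_past_noise.
move=> n; have ma : measurable_fun [set: pastType w n] (closed_loop pb w pi z n).
  exact: (measurableT_comp mpi (@mstate n)).
split.
  have := measurableT_comp (@measurable_fst _ _ _ _) ma.
  move=> /(_ measurableT [set true]); rewrite setTI; apply.
  by [].
move=> B mB.
have := measurableT_comp (@measurable_snd _ _ _ _) ma.
by move=> /(_ measurableT B mB); rewrite setTI.
Qed.

Variables (V : R * nat -> R) (Vmax : R).
Hypotheses (V_bound : forall z, 0 <= V z <= Vmax) (mV : measurable_fun setT V).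

(** Expected cost of taking the action [a] in the state [z] and of continuing
    with the value [V] afterwards. *)
Definition action_value (z : R * nat) (a : bool * R) : \bar R :=
  (\int[distribution P (w 0%N)]_v
    (step_cost pb z a v + g * V (step pb z a v))%:E)%E.

Lemma step_cost_ge0 z a v : 0 <= step_cost pb z a v.
Proof.
have [_ stage0 _ reset_ge0 _] := standing.
by rewrite addr_ge0 ?stage0// mulr_ge0 ?reset_ge0.
Qed.

Let V_ge0 z : 0 <= V z. Proof. by have /andP[] := V_bound z. Qed.

Section Run.
Variables (z : R * nat) (a : nat -> T -> bool * R).
Hypothesis na : nonanticipative w a.
Local Notation st := (state pb w z a).
Local Notation e := (fun n => \int[P]_om (V (st n om))%:E)%E.
Local Notation cost n om := (step_cost pb (st n om) (a n om) (w n om)).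
Local Notation cc := (fun n => \int[P]_om (cost n om)%:E)%E.

Let mF n : measurable_fun [set: pastType w n * R]
  (fun x => (step_cost pb (st n x.1) (a n x.1) x.2
             + g * V (step pb (st n x.1) (a n x.1) x.2))%:E).
Proof.
have m1 := measurableT_comp (measurable_state z (n := n) na)
  (@measurable_fst _ _ (pastType w n) R).
have m2 := measurableT_comp (measurable_control (n := n) na)
  (@measurable_fst _ _ (pastType w n) R).
apply/measurable_EFinP/measurable_funD.
  exact: (measurable_step_cost m1 m2 (@measurable_snd _ _ (pastType w n) R)).
apply: measurable_funM => //.
apply: (measurableT_comp mV).
exact: (measurable_step m1 m2 (@measurable_snd _ _ (pastType w n) R)).
Qed.

Let F_ge0 n x : (0 <= (step_cost pb (st n x.1) (a n x.1) x.2
             + g * V (step pb (st n x.1) (a n x.1) x.2))%:E)%E.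
Proof.
rewrite lee_fin addr_ge0 ?step_cost_ge0// mulr_ge0//.
by case/andP: discount01.
Qed.

Let mstate n : measurable_fun [set: T] (st n).
Proof. exact: measurable_past (measurable_state z na). Qed.

Let mcost n : measurable_fun [set: T] (fun om => cost n om).
Proof.
apply: measurable_step_cost => //.
exact: measurable_past (measurable_control na).
Qed.

Let mVst n : measurable_fun [set: T] (fun om => (V (st n om))%:E).
Proof. by apply/measurable_EFinP; exact: measurableT_comp mV (@mstate n). Qed.

Lemma measurable_action_value n :
  measurable_fun [set: T] (fun om => action_value (st n om) (a n om)).
Proof.
exact: measurable_past (@measurable_fun_fubini_tonelli_F _ _ _ _ _
  (distribution P (w 0%N)) _ (@mF n) (F_ge0 n)).
Qed.

Lemma expected_action_value n : (cc n + g%:E * e n.+1 =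
  \int[P]_om action_value (st n om) (a n om))%E.
Proof.
have g0 : 0 <= g by case/andP: discount01.
have := freezing w_indep w_ident (@mF n) (F_ge0 n).
rewrite /= -/(action_value _ _) => <-.
rewrite -ge0_integralZl//; last 2 first.
- exact: (mVst n.+1).
- by move=> om _; rewrite lee_fin.
rewrite -ge0_integralD//.
- by move=> om _; rewrite lee_fin step_cost_ge0.
- exact/measurable_EFinP.
- by move=> om _; rewrite lee_fin mulr_ge0.
- by apply: emeasurable_funM => //; exact: (mVst n.+1).
Qed.

Lemma total_costE : (total_cost pb w z a = \sum_(0 <= n <oo) (g ^+ n)%:E * cc n)%E.
Proof.
have g0 : 0 <= g by case/andP: discount01.
rewrite /total_cost integral_nneseries//.
- apply: eq_eseriesr => n _; rewrite -ge0_integralZl//.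
  + exact/measurable_EFinP.
  + by move=> om _; rewrite lee_fin step_cost_ge0.
  + by rewrite lee_fin exprn_ge0.
- by move=> n; apply/measurable_EFinP; exact: measurable_funM.
- by move=> n om _; rewrite lee_fin mulr_ge0 ?exprn_ge0// step_cost_ge0.
Qed.

Let e_bound n : (0 <= e n <= Vmax%:E)%E.
Proof.
rewrite integral_ge0/=; last by move=> om _; rewrite lee_fin.
apply: (@le_trans _ _ (\int[P]_om Vmax%:E)%E).
  apply: ge0_le_integral => //; first by move=> om _; rewrite lee_fin.
  by move=> om _; rewrite lee_fin; case/andP: (V_bound (st n om)).
rewrite [leLHS](integral_cst P measurableT Vmax%:E) [X in (_ * X)%E](_ : _ = 1%E).
  by rewrite mule1.
exact: probability_setT.
Qed.

Let e0 : e 0%N = (V z)%:E.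
Proof.
rewrite [LHS](integral_cst P measurableT (V z)%:E) [X in (_ * X)%E](_ : _ = 1%E).
  by rewrite mule1.
exact: probability_setT.
Qed.

Let cc_ge0 n : (0 <= cc n)%E.
Proof. by apply: integral_ge0 => om _; rewrite lee_fin step_cost_ge0. Qed.

Let gn0 n : (0 <= (g ^+ n)%:E)%E.
Proof. by rewrite lee_fin exprn_ge0//; case/andP: discount01. Qed.

Let partial n := (\sum_(0 <= i < n) (g ^+ i)%:E * cc i)%E.

Let partialS n : (partial n + (g ^+ n)%:E * (cc n + g%:E * e n.+1)
  = partial n.+1 + (g ^+ n.+1)%:E * e n.+1)%E.
Proof.
have g0 : (0 <= g%:E)%E by rewrite lee_fin; case/andP: discount01.
rewrite /partial big_nat_recr//= ge0_muleDr//; last first.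
  by rewrite mule_ge0//; have /andP[] := e_bound n.+1.
by rewrite addeA muleA -EFinM exprSr.
Qed.

Let partial_le n : (partial n <= total_cost pb w z a)%E.
Proof.
rewrite total_costE; apply: nneseries_lim_ge => i _ _.
by rewrite mule_ge0.
Qed.

(** Each action costs on average at least the decrease that it causes in the
    discounted expectation of [V], and this expectation tends to zero since [V]
    is bounded. *)
Lemma verification_lower :
  (forall n, {ae P, forall om, (V (st n om))%:E <= action_value (st n om) (a n om)})%E ->
  ((V z)%:E <= total_cost pb w z a)%E.
Proof.
move=> Vle.
have e_le n : (e n <= cc n + g%:E * e n.+1)%E.
  rewrite expected_action_value; apply: ae_ge0_le_integral => //.
  - by move=> om _; rewrite lee_fin.
  - by move=> om _; apply: integral_ge0 => v _; exact: (F_ge0 n (om, v)).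
  - exact: measurable_action_value.
  - by apply: filterS (Vle n) => om h _.
have V_le n : ((V z)%:E <= partial n + (g ^+ n)%:E * e n)%E.
  elim: n => [|n IH].
    by rewrite /partial big_geq// add0e expr0 mul1e e0.
  by apply: le_trans IH _; rewrite -partialS leeD2l// lee_wpmul2l.
have V_le_total n : ((V z)%:E <= total_cost pb w z a + (g ^+ n * Vmax)%:E)%E.
  apply: le_trans (V_le n) _; apply: leeD => //.
  by rewrite EFinM lee_wpmul2l//; case/andP: (e_bound n).
have g_cvg : (fun n => g ^+ n * Vmax) @ \oo --> (0 : R).
  rewrite -[X in _ --> X](mul0r Vmax); apply: cvgMl.
  by have /andP[h1 h2] := discount01; apply: cvg_expr; rewrite ger0_norm.
case E : (total_cost pb w z a) => [r| |].
- rewrite lee_fin leNgt; apply/negP => rV.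
  have Vr : 0 < V z - r by rewrite subr_gt0.
  have [n _ /(_ n (leqnn n)) gn] := cvgr_lt _ g_cvg _ Vr.
  by have := V_le_total n; rewrite E -EFinD lee_fin; lra.
- by rewrite leey.
- by have := V_le_total 0%N; rewrite E.
Qed.

Lemma verification_upper :
  (forall n, {ae P, forall om, action_value (st n om) (a n om) = (V (st n om))%:E})%E ->
  (total_cost pb w z a <= (V z)%:E)%E.
Proof.
move=> Veq.
have e_eq n : (cc n + g%:E * e n.+1 = e n)%E.
  rewrite expected_action_value; apply: ae_eq_integral => //.
  - exact: measurable_action_value.
  - by apply: filterS (Veq n) => om h _.
have V_eq n : ((V z)%:E = partial n + (g ^+ n)%:E * e n)%E.
  elim: n => [|n IH].
    by rewrite /partial big_geq// add0e expr0 mul1e e0.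
  by rewrite IH -partialS e_eq.
rewrite total_costE; apply: lime_le.
  by apply: is_cvg_nneseries => n _ _; rewrite mule_ge0.
apply: nearW => n; rewrite (V_eq n) leeDl//.
by rewrite mule_ge0//; case/andP: (e_bound n).
Qed.

End Run.

Let cmax0 : 0 <= cmax. Proof. by case: adm. Qed.

Definition safe (z : R * nat) := 0 <= z.1 <= cmax /\ (z.2 <= k)%N.

(** The actions that keep the state within the constraints, whatever
    nonnegative disturbance occurs. *)
Definition feasible (z : R * nat) (a : bool * R) :=
  (z.2 = k -> a.1) /\ 0 <= a.2 <= cmax - (after_reset pb z a.1).1.

Lemma after_reset_ge0 z b : safe z -> 0 <= (after_reset pb z b).1 <= cmax.
Proof. by case=> zc _; case: b => //=; rewrite reset0 lexx. Qed.

Lemma safe_step z a v : safe z -> feasible z a -> 0 <= v -> safe (step pb z a v).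
Proof.
move=> zs [ar auc] v0; have := after_reset_ge0 a.1 zs.
rewrite /step; split=> /=.
  by rewrite dyn le_max lexx orbT/= ge_max cmax0 andbT; lra.
case: zs => _; rewrite leq_eqVlt /after_reset => /predU1P[zk|].
  by rewrite (ar zk) /=; have [] := standing.
by case: ifP => //= _ _; have [] := standing.
Qed.

Lemma admissible_safe_feasible z a : safe z -> admissible pb w z a -> forall n,
  {ae P, forall om, safe (state pb w z a n om) /\ feasible (state pb w z a n om) (a n om)}.
Proof.
move=> zs [na ok].
have feas n : {ae P, forall om, feasible (state pb w z a n om) (a n om)}.
  apply: filterS2 (ok n) (ok n.+1) => om [h1 h2] [h3 _]; split.
    move=> zk; case E : (a n om).1 => //.
    by move: h3; rewrite /= /step /after_reset E /= zk ltnn.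
  by have [_ adm'] := adm; move: h2; rewrite adm'.
elim=> [|n IH]; first by apply: filterS (feas 0%N) => om.
apply: filterS3 IH (feas n.+1) (w_ge0 n) => om [h1 h2] h3 h4; split => //.
exact: safe_step.
Qed.

Lemma closed_loop_safe (pi : policy) z : safe z ->
  (forall y, safe y -> feasible y (pi y.1 y.2)) -> forall n,
  {ae P, forall om, safe (closed_loop_state pb w pi z n om)}.
Proof.
move=> zs pif; elim=> [|n IH]; first by apply: aeW.
apply: filterS2 IH (w_ge0 n) => om h1 h2.
by apply: safe_step => //; exact: pif.
Qed.

(** Every admissible control keeps the state within the constraints almost
    surely, so its cost is bounded below by [V]; under [pi] the inequality is an
    equality at every step. *)
Lemma verification (pi : policy) :
  measurable_fun setT (fun y : R * nat => pi y.1 y.2) ->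
  (forall z a, safe z -> feasible z a -> (V z)%:E <= action_value z a)%E ->
  (forall z, safe z -> feasible z (pi z.1 z.2) /\
     action_value z (pi z.1 z.2) = (V z)%:E) ->
  optimal_policy pb w `[0, cmax] pi /\
  forall x t, 0 <= x <= cmax -> (t <= k)%N -> value pb w x t = (V (x, t))%:E.
Proof.
move=> mpi Vle Vpi.
have pi_adm x t : 0 <= x <= cmax -> (t <= k)%N ->
    admissible pb w (x, t) (closed_loop pb w pi (x, t)).
  move=> xc tk; split; first exact: closed_loop_nonanticipative.
  move=> n; have xts : safe (x, t) by [].
  apply: filterS (closed_loop_safe xts (fun y ys => (Vpi y ys).1) n) => om ys.
  rewrite state_closed_loop /closed_loop.
  have [[_ uc] _] := Vpi _ ys; case: ys => _ tk'; split=> //.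
  by have [_ ->] := adm.
have pi_cost x t : 0 <= x <= cmax -> (t <= k)%N ->
    (total_cost pb w (x, t) (closed_loop pb w pi (x, t)) <= (V (x, t))%:E)%E.
  move=> xc tk; apply: verification_upper; first by have [] := pi_adm x t xc tk.
  move=> n; have xts : safe (x, t) by [].
  apply: filterS (closed_loop_safe xts (fun y ys => (Vpi y ys).1) n) => om ys.
  by rewrite state_closed_loop /closed_loop (Vpi _ ys).2.
have valueE x t : 0 <= x <= cmax -> (t <= k)%N -> value pb w x t = (V (x, t))%:E.
  move=> xc tk; apply/eqP; rewrite eq_le; apply/andP; split.
    apply: le_trans (pi_cost x t xc tk); apply: ereal_inf_lbound.
    by exists (closed_loop pb w pi (x, t)) => //; exact: pi_adm.
  apply: le_ereal_inf_tmp => _ [a aadm <-]; apply: verification_lower.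
    by have [] := aadm.
  move=> n; have xts : safe (x, t) by [].
  by apply: filterS (admissible_safe_feasible xts aadm n) => om [ys yf]; exact: Vle.
split=> // x t; rewrite /= in_itv/= => xc tk; split; first exact: pi_adm.
apply/eqP; rewrite eq_le; apply/andP; split.
  by rewrite valueE//; exact: pi_cost.
apply: ereal_inf_lbound.
by exists (closed_loop pb w pi (x, t)) => //; exact: pi_adm.
Qed.

End Verification.

(** * The reset control problem *)

Section ResetProblem.
Context {R : realType} {d : measure_display} {T : measurableType d}
  {P : probability T R}.
Variables (w : nat -> {RV P >-> R}) (pb : problem R)
  (cmax c K : R) (H : R -> nat -> R) (kappa m eta Lr : nat -> R)
  (f : R -> R) (L Pf : R).
Hypotheses (hstanding : standing_assumptions pb) (hA1 : A1 pb)
  (hA2 : A2 pb w cmax c K H kappa m) (hA3 : A3 pb w eta Lr) (hA4 : A4 pb cmax)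
  (hA5 : A5 w f L Pf) (hdiscount : 0 <= discount pb < 1)
  (hbound : forall t, (t < period pb)%N ->
     ((discount pb)%:E
        <= discount_bound (period pb) cmax c L Pf kappa m eta t)%E).
Local Notation g := (discount pb).
Local Notation k := (period pb).
Local Notation A := (L * cmax + Pf).
Local Notation r := (mean_reset_cost pb w).
Implicit Types (x y u p v : R) (t : nat).

Lemma measurable_noise :
  measurable_fun [set: T] (w 0%N : T -> measurableTypeR R).
Proof. exact: (measurable_funP (w 0%N)). Qed.

Definition noise : {mfun T >-> measurableTypeR R} :=
  HB.pack (w 0%N : T -> measurableTypeR R)
    (isMeasurableFun.Build _ _ _ _ _ measurable_noise).

(** The law of the disturbances, on the reals as the domain of the Lebesgue
    measure. *)
Definition noise_law : probability (measurableTypeR R) R :=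
  distribution P noise.
Local Notation mu := noise_law.

Lemma noise_independent : independent_seq w.
Proof. by case: hA5. Qed.

Lemma noise_identical n (B : set R) : measurable B ->
  distribution P (w n) B = distribution P (w 0%N) B.
Proof. by move=> mB; have [_ [_ fE] _ _ _] := hA5; rewrite !fE. Qed.

Lemma noise_ge0 n : {ae P, forall om, 0 <= w n om}.
Proof.
have [_ [f0 fE] f_lt0 _ _] := hA5.
exists (w n @^-1` `]-oo, 0[); split.
- by rewrite -[X in measurable X]setTI; exact: (measurable_funP (w n)).
- have /= := fE n `]-oo, 0[%classic (measurable_itv _).
  rewrite /distribution /pushforward => ->.
  apply: integral0_eq => y; rewrite /= in_itv/= => y0.
  by rewrite f_lt0.
- by move=> om /=; rewrite in_itv/= => /negP; rewrite -ltNge.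
Qed.

(** If [L cmax + Pf] vanished, so would the density, whose integral is [1]. *)
Lemma density_scale_gt0 : 0 < A.
Proof.
have [_ [f0 fE] f_lt0 [L0 _] [P0 fP]] := hA5; have [cmax0 _] := hA4.
have A0 : 0 <= A by rewrite addr_ge0// mulr_ge0.
rewrite lt_neqAle A0 andbT; apply/eqP => A_eq.
have Pf0 : Pf = 0.
  apply/eqP; rewrite eq_le P0 andbT A_eq lerDr.
  by rewrite mulr_ge0.
have f_eq0 y : f y = 0.
  have [y0|y0] := ltP y 0; first exact: f_lt0.
  by apply/eqP; rewrite -normr_eq0 eq_le normr_ge0 andbT -{1}Pf0 fP.
have := fE 0%N setT measurableT; rewrite probability_setT.
under eq_integral do rewrite f_eq0.
by rewrite integral0 => /eqP; rewrite eqe oner_eq0.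
Qed.

Lemma expect_reset t x : (t <= k)%N -> 0 <= x ->
  expect w (fun v => (reset_cost pb x t v)%:E) = (r x t)%:E.
Proof.
move=> tk x0; have [_ /(_ t tk)[_ fin _ _ _]] := hA3.
by rewrite /mean_reset_cost fineK// fin.
Qed.

Lemma mean_reset_ge0 t x : 0 <= r x t.
Proof.
have [_ _ _ reset_ge0 _] := hstanding.
by rewrite fine_ge0// integral_ge0// => om _; rewrite lee_fin.
Qed.

Lemma mean_reset_derive t : (t <= k)%N -> exists dR : R -> R,
  (forall x, 0 <= x -> derive_in `[0, +oo[ (r ^~ t) x (dR x) /\ `|dR x| <= eta t) /\
  forall x y, 0 <= x -> 0 <= y -> `|dR x - dR y| <= Lr t * `|x - y|.
Proof.
move=> tk; have [_ /(_ t tk)[_ _ _ _ [dR [dRP dRlip]]]] := hA3.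
exists dR; split=> // x y x0 y0.
by have := @dRlip (x, y); rewrite /= !in_itv/= !andbT; apply.
Qed.

Lemma mean_reset_lipschitz t x y : (t <= k)%N -> 0 <= x <= cmax ->
  0 <= y <= cmax -> `|r x t - r y t| <= eta t * `|x - y|.
Proof.
move=> tk; have [dR [dRP _]] := mean_reset_derive tk.
apply: (@derive_in_lipschitz _ 0 cmax (eta t) (r ^~ t) dR) => z /andP[z0 zc].
- apply: derive_in_sub (dRP z z0).1 => //=.
  + by move=> q /=; rewrite !in_itv/= => /andP[->].
  + by rewrite in_itv/= z0.
- exact: (dRP z z0).2.
Qed.

Lemma mean_reset_nondecreasing t x y : (t <= k)%N -> 0 <= x -> x <= y ->
  r x t <= r y t.
Proof. by move=> tk; have [_ /(_ t tk)[_ _ _ nd _]] := hA3; exact: nd. Qed.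

Lemma mean_reset_concave t x y p : (t <= k)%N -> 0 <= x -> 0 <= y ->
  0 <= p <= 1 -> p * r x t + (1 - p) * r y t <= r (p * x + (1 - p) * y) t.
Proof. by move=> tk; have [_ /(_ t tk)[_ _ cv _ _]] := hA3; exact: cv. Qed.

Lemma stage_cost_ge0 t x u : (t < k)%N -> 0 <= x -> 0 <= u <= cmax - x ->
  0 <= c * u + K * (0 < u)%R%:R + H (x + u) t.
Proof.
move=> tk x0 uc; have [_ _ stageE _] := hA2; have [_ stage_ge0 _ _ _] := hstanding.
rewrite -lee_fin -stageE//; apply: integral_ge0 => om _.
by rewrite lee_fin.
Qed.

Lemma discount_last : g * eta k <= m k.-1 / A.
Proof.
have [k0 _ _ _ _] := hstanding; have A0 := density_scale_gt0.
have [_ /(_ k (leqnn k))[[eta0 _] _ _ _ _]] := hA3.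
have k1k : (k.-1 < k)%N by rewrite prednK.
have [_ /(_ _ k1k)[_ m0] _ _] := hA2.
have := hbound k1k; rewrite /discount_bound prednK// eqxx.
have [e0|e0] := eqVneq (eta k) 0.
  by move=> _; rewrite e0 mulr0 divr_ge0// ltW.
have Ae : 0 < A * eta k by rewrite mulr_gt0// lt_neqAle eq_sym e0.
rewrite inver gt_eqF// -EFinM lee_fin ler_pdivlMr// => h.
by rewrite ler_pdivlMr// mulrAC -mulrA.
Qed.

Lemma discount_stage t : (t.+1 < k)%N ->
  g * slope_bound cmax c L Pf kappa m eta t.+1 <= m t / A.
Proof.
move=> tk; have A0 := density_scale_gt0.
have [[c0 _] /(_ _ tk)[kappa0 m0] _ _] := hA2.
have [_ /(_ _ (ltnW tk))[[eta0 _] _ _ _ _]] := hA3.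
have := hbound (ltnW tk); rewrite /discount_bound ltn_eqF//.
have D0 : 0 < A * (eta t.+1 + c + kappa t.+1) + m t.+1.
  by rewrite ltr_wpDl// mulr_ge0 ?(ltW A0)// !addr_ge0.
rewrite inver gt_eqF// -EFinM lee_fin ler_pdivlMr// => h.
rewrite ler_pdivlMr// /slope_bound -mulrA mulrDl divfK ?gt_eqF//.
by rewrite (mulrC _ A).
Qed.

Local Notation Phi t V := (stage_continuation mu g H t V).

(** Regularity is recorded for [Phi t (V t.+1)], the cost of continuing without
    an order, on which the thresholds of stage [t] depend. *)
Lemma reset_dynamic_program : exists j (V : nat -> R -> R), [/\ 0 <= j,
  forall t, (t <= k)%N -> exists2 M, 0 <= M & regular cmax M (V t),
  forall x, V k x = j + r (clamp cmax x) k,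
  forall t, (t < k)%N -> [/\
    forall x y, 0 <= x <= cmax -> 0 <= y <= cmax ->
      `|Phi t (V t.+1) x - Phi t (V t.+1) y| <= (kappa t + m t / A) * `|x - y|,
    forall x y p, 0 <= x <= cmax -> 0 <= y <= cmax -> 0 <= p <= 1 ->
      Phi t (V t.+1) (p * x + (1 - p) * y)
        <= p * Phi t (V t.+1) x + (1 - p) * Phi t (V t.+1) y,
    exists D, [/\ forall y, 0 <= y <= cmax ->
        derive_in `[0, cmax] (Phi t (V t.+1)) y (D y),
      forall y, 0 <= y <= cmax -> `|D y| <= kappa t + m t / A
      & exists2 C : R, 0 <= C & forall x y, 0 <= x <= cmax -> 0 <= y <= cmax ->
        `|D x - D y| <= C * `|x - y|]
    & forall x, 0 <= x <= cmax -> V t x = Num.min (j + r x t)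
      (best_order_cost cmax c K (Phi t (V t.+1)) x)]
  & j = best_order_cost cmax c K (Phi 0 (V 1%N)) 0].
Proof.
have [_ [f0 fE] f_lt0 [L0 f_lip] [P0 fP]] := hA5; have [cmax0 _] := hA4.
have muE : forall B : set (measurableTypeR R), measurable B ->
    mu B = (\int[lebesgue_measure]_(y in B) (f y)%:E)%E := fE 0%N.
have A0 := density_scale_gt0.
have [k0 _ _ _ _] := hstanding.
have [[c0 K0] km0 _ [dH [ddH dHP]]] := hA2.
have /andP[g0 g1] := hdiscount.
have kappa0 t (tk : (t < k)%N) := (km0 t tk).1.
have m0 t (tk : (t < k)%N) := (km0 t tk).2.
have dH1 t y : (t < k)%N -> 0 <= y <= cmax ->
    derive_in `[0, cmax] (H ^~ t) y (dH y t).
  by move=> tk yc; have [/(_ y yc)[]] := dHP t tk.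
have ddH1 t y : (t < k)%N -> 0 <= y <= cmax ->
    derive_in `[0, cmax] (dH ^~ t) y (ddH y t).
  by move=> tk yc; have [/(_ y yc)[]] := dHP t tk.
have dH_bound t y : (t < k)%N -> 0 <= y <= cmax -> `|dH y t| <= kappa t.
  by move=> tk yc; have [/(_ y yc)[]] := dHP t tk.
have ddH_bound t : (t < k)%N -> exists B, forall y, 0 <= y <= cmax ->
    m t <= ddH y t <= B.
  move=> tk; have [h1 [B h2]] := dHP t tk; exists B => y yc.
  by have [_ _ _ ->] := h1 y yc; rewrite h2.
have eta0 t : (t <= k)%N -> 0 <= eta t.
  by move=> tk; have [_ /(_ t tk)[[]]] := hA3.
have r_ge0 t x : (t <= k)%N -> 0 <= x -> 0 <= r x t by move=> _ _; exact: mean_reset_ge0.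
have [j [V [j0 Vreg Vk Vt jE]]] := dynamic_program_solution f0 muE f_lt0 L0 f_lip
  P0 fP k0 cmax0 g0 g1 c0 K0 kappa0 m0 dH1 ddH1 dH_bound ddH_bound
  stage_cost_ge0 eta0 r_ge0 mean_reset_lipschitz mean_reset_nondecreasing A0
  discount_last discount_stage.
exists j, V; split=> // t tk; have [[M [M0 gM [V_lip VE V_ge0]]] VtE] := Vt t tk.
split=> //.
- exact: (stage_lipschitz f0 muE f_lt0 L0 f_lip P0 fP cmax0 g0 m0 dH1 ddH1
    dH_bound ddH_bound A0 tk M0 V_lip VE gM).
- exact: (stage_convex f0 muE f_lt0 L0 f_lip P0 fP cmax0 g0 m0 dH1 ddH1
    dH_bound ddH_bound A0 tk M0 V_lip VE gM).
- exact: (stage_smooth f0 muE f_lt0 L0 f_lip P0 fP cmax0 g0 m0 dH1 ddH1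
    dH_bound ddH_bound A0 tk M0 V_lip VE gM).
Qed.


Lemma noise_integral (F : R -> \bar R) : measurable_fun setT F ->
  (forall v, 0 <= F v)%E ->
  (\int[distribution P (w 0%N)]_v F v = \int[mu]_v F v)%E.
Proof.
move=> mF F0; rewrite ge0_integral_distribution//.
by rewrite (@ge0_integral_distribution _ _ _ _ _ P noise F).
Qed.

Lemma expected_value_mean (V : R -> R) M y : 0 <= M -> regular cmax M V ->
  (\int[distribution P (w 0%N)]_v (V (Num.max (y - v) 0))%:E
    = (mean mu V y)%:E)%E.
Proof.
move=> M0 [V_lip VE V_ge0]; have [cmax0 _] := hA4.
have -> : (fun v => (V (Num.max (y - v) 0))%:E) = (fun v => (V (y - v))%:E).
  apply/funext => v; rewrite (VE (Num.max _ _)) (VE (y - v)); congr ((V _)%:E).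
  case: (leP (y - v) 0) => yv //.
  by rewrite (clamp_le0 _ yv) clamp_id ?lexx.
have mV : measurable_fun setT (fun v => (V (y - v))%:E).
  apply/measurable_EFinP; apply: (@measurableT_comp _ _ _ _ _ _ V _ (fun v => y - v)).
    exact: klipschitz_measurable V_lip.
  exact: measurable_funB.
rewrite noise_integral//; last by move=> v; rewrite lee_fin.
have [_ Vb _] := clamped_lipschitz cmax0 M0 (fun x y _ _ => V_lip x y) VE.
rewrite /mean /Rintegral fineK//.
have := integrable_fin_num measurableT (mean_integrable mu V_lip Vb y).
by [].
Qed.

(** The value of the states with clock beyond [k], which are not admissible, is
    set to [0] to keep the function bounded. *)
Definition state_value (V : nat -> R -> R) (z : R * nat) : R :=
  if (z.2 <= k)%N then V z.2 z.1 else 0.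

Section ActionValue.
Variable V : nat -> R -> R.
Hypothesis V_reg : forall t, (t <= k)%N -> exists2 M, 0 <= M & regular cmax M (V t).

Lemma state_value_measurable : measurable_fun setT (state_value V).
Proof.
have cvg (x _q _v : R) t : state_value V (grid N x, t) @[N --> \oo] --> state_value V (x, t).
  rewrite /state_value /=; case: ifPn => tk; last exact: cvg_cst.
  have [M _ [V_lip _ _]] := V_reg tk.
  apply: (cvg_comp (fun N => grid N x) (V t) _ (@klipschitz_cont _ (V t) M V_lip x)).
  exact: grid_cvg.
have m1 := @measurable_fst _ _ R nat.
have m2 := @measurable_snd _ _ R nat.
have := measurable_grid_limit cvg m1 m1 m1 m2.
by apply: eq_measurable_fun => -[].
Qed.

Lemma state_value_bound : exists B, forall z, 0 <= state_value V z <= B.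
Proof.
have [cmax0 _] := hA4.
have bound t : exists B, 0 <= B /\ ((t <= k)%N -> forall x, 0 <= V t x <= B).
  have [tk|tk] := boolP (t <= k)%N; last by exists 0.
  have [M M0 [V_lip VE V_ge0]] := V_reg tk.
  have [_ Vb _] := clamped_lipschitz cmax0 M0 (fun x y _ _ => V_lip x y) VE.
  exists (`|V t 0| + M * cmax); split; first by rewrite addr_ge0// mulr_ge0.
  by move=> _ x; rewrite V_ge0/= (le_trans (ler_norm _)).
have /choice[B BP] := bound.
exists (\sum_(t < k.+1) B t) => -[x t]; rewrite /state_value /=.
have B0 : 0 <= \sum_(t < k.+1) B t by apply: sumr_ge0 => i _; have [] := BP i.
case: ifPn => tk; last by rewrite lexx.
have [_ /(_ tk x)/andP[-> h]] := BP t; apply: le_trans h _ => /=.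
rewrite (bigD1 (Ordinal (tk : (t < k.+1)%N)))//= lerDl.
by apply: sumr_ge0 => i _; have [] := BP i.
Qed.

Lemma action_valueE z b u :
  let p := after_reset pb z b in
  (z.2 <= k)%N -> 0 <= z.1 -> (p.2 < k)%N -> 0 <= p.1 -> 0 <= u <= cmax - p.1 ->
  action_value w pb (state_value V) z (b, u) =
    (r z.1 z.2 * b%:R + order_cost c K (Phi p.2 (V p.2.+1)) p.1 u)%:E.
Proof.
move=> p zk z0 pk p0 uc; have /andP[g0 _] := hdiscount.
have [_ stage_ge0 _ reset_ge0 _] := hstanding; have [_ _ stageE _] := hA2.
have [M M0 Vreg] := V_reg pk; have [V_lip _ V_ge0] := Vreg.
pose F1 v := (stage_cost pb p.1 p.2 u v)%:E.
pose F2 v := ((reset_cost pb z.1 z.2 v) * b%:R)%:E.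
pose F3 v := (g * V p.2.+1 (Num.max (p.1 + u - v) 0))%:E.
have mc (q : R) : measurable_fun [set: R] (cst q) by exact: measurable_cst.
have mt (q : nat) : measurable_fun [set: R] (cst q) by exact: measurable_cst.
have mid : measurable_fun [set: R] (@id R) by exact: measurable_id.
have m1 : measurable_fun setT F1.
  apply/measurable_EFinP.
  exact: (measurable_stage_cost hstanding (mc p.1) (mc u) mid (mt p.2)).
have mr := measurable_reset_cost hstanding (mc z.1) mid (mt z.2).
have m2 : measurable_fun setT F2.
  by apply/measurable_EFinP; apply: measurable_funM => //.
have mV : measurable_fun setT (fun v => (V p.2.+1 (Num.max (p.1 + u - v) 0))%:E).
  apply/measurable_EFinP; apply: (measurableT_comp (klipschitz_measurable V_lip)).
  by apply: measurable_maxr => //; exact: measurable_funB.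
have m3 : measurable_fun setT F3.
  rewrite /F3; under eq_fun do rewrite EFinM.
  exact: emeasurable_funM.
have F10 v : (0 <= F1 v)%E by rewrite lee_fin.
have F20 v : (0 <= F2 v)%E by rewrite lee_fin mulr_ge0.
have F30 v : (0 <= F3 v)%E by rewrite lee_fin mulr_ge0.
transitivity (\int[distribution P (w 0%N)]_v (F1 v + F2 v + F3 v))%E.
  apply: eq_integral => v _; rewrite /step_cost /state_value /= pk hA1 -/p.
  by rewrite /F1 /F2 /F3 -!EFinD.
rewrite ge0_integralD//; [|by move=> v _; rewrite adde_ge0|exact: emeasurable_funD].
rewrite ge0_integralD//.
have -> : (\int[distribution P (w 0%N)]_v F1 v =
    (c * u + K * (0 < u)%R%:R + H (p.1 + u) p.2)%:E)%E.
  by rewrite ge0_integral_distribution//; exact: stageE.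
have -> : (\int[distribution P (w 0%N)]_v F2 v = (r z.1 z.2 * b%:R)%:E)%E.
  rewrite ge0_integral_distribution// /F2 /comp /=; case: (b) => /=.
    by rewrite mulr1 -(expect_reset zk z0); apply: eq_integral => om _ /=; rewrite mulr1.
  rewrite mulr0; under eq_integral do rewrite mulr0.
  exact: integral0.
have -> : (\int[distribution P (w 0%N)]_v F3 v = (g * mean mu (V p.2.+1) (p.1 + u))%:E)%E.
  rewrite /F3; under eq_integral do rewrite EFinM.
  rewrite ge0_integralZl//; last by move=> v _; rewrite lee_fin.
  by rewrite (expected_value_mean _ M0 Vreg).
rewrite -!EFinD; congr (_%:E).
by rewrite /order_cost /stage_continuation /continuation; ring.
Qed.

End ActionValue.

(** Integrals of nonnegative functions are lower integrals, hence monotone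
    without measurability. *)
Lemma le_lower_integral (F G : T -> \bar R) :
  (forall om, 0 <= F om)%E -> (forall om, F om <= G om)%E ->
  (\int[P]_om F om <= \int[P]_om G om)%E.
Proof.
move=> F0 FG; rewrite !ge0_integralTE//; last by move=> om; exact: le_trans (FG om).
apply: ge_ereal_sup => _ [h hF <-]; apply: ereal_sup_ubound.
by exists h => //= om; exact: le_trans (FG om).
Qed.

(** [J] is known on [[0, cmax]].  Its values elsewhere enter on the null event
    where the disturbance is negative; there they lie between [0] and [+oo], and
    replacing them by either bound gives a measurable integrand with the same
    integral. *)
Lemma expect_value (J : R -> \bar R) (V : R -> R) M y : 0 <= M -> regular cmax M V ->
  (forall x, 0 <= J x)%E -> (forall x, 0 <= x <= cmax -> J x = (V x)%:E) ->
  0 <= y <= cmax ->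
  expect w (fun v => J (Num.max (y - v) 0)) = (mean mu V y)%:E.
Proof.
move=> M0 Vreg J0 JV yc; have [V_lip VE V_ge0] := Vreg.
have mV : measurable_fun setT (fun om => V (Num.max (y - w 0%N om) 0)).
  apply: (measurableT_comp (klipschitz_measurable V_lip)).
  apply: measurable_maxr => //; exact: measurable_funB.
have mw : measurable_fun [set: T] (fun om => w 0%N om < 0).
  by apply: measurable_fun_ltr => //; exact: measurable_cst.
pose lo om := if w 0%N om < 0 then 0%E else (V (Num.max (y - w 0%N om) 0))%:E.
pose hi om := if w 0%N om < 0 then +oo%E else (V (Num.max (y - w 0%N om) 0))%:E.
have mlo : measurable_fun setT lo by apply: measurable_fun_ifT => //; exact/measurable_EFinP.
have mhi : measurable_fun setT hi by apply: measurable_fun_ifT => //; exact/measurable_EFinP.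
have lo0 om : (0 <= lo om)%E by rewrite /lo; case: ifP => // _; rewrite lee_fin.
have hi0 om : (0 <= hi om)%E by rewrite /hi; case: ifP => // _; rewrite lee_fin.
have JE om : ~~ (w 0%N om < 0) ->
    J (Num.max (y - w 0%N om) 0) = (V (Num.max (y - w 0%N om) 0))%:E.
  rewrite -leNgt => w0; apply: JV; rewrite le_max lexx orbT/= ge_max.
  by move: yc => /andP[y0 yc]; rewrite (le_trans y0 yc) andbT; lra.
have mean_eq (F : T -> \bar R) : measurable_fun setT F ->
    (forall om, ~~ (w 0%N om < 0) -> F om = (V (Num.max (y - w 0%N om) 0))%:E) ->
    (\int[P]_om F om = (mean mu V y)%:E)%E.
  move=> mF FE; rewrite -(expected_value_mean _ M0 Vreg).
  rewrite ge0_integral_distribution//; first last.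
  - by move=> v; rewrite lee_fin.
  - apply/measurable_EFinP; apply: (measurableT_comp (klipschitz_measurable V_lip)).
    by apply: measurable_maxr => //; exact: measurable_funB.
  apply: ae_eq_integral => //; first exact/measurable_EFinP.
  by apply: filterS (noise_ge0 0) => om w0 _; apply: FE; rewrite -leNgt.
apply/eqP; rewrite eq_le; apply/andP; split.
  rewrite -(mean_eq hi mhi); last by move=> om /negbTE; rewrite /hi => ->.
  apply: le_lower_integral => // om; rewrite /hi; case: ifPn => w0; first exact: leey.
  by rewrite JE.
rewrite -(mean_eq lo mlo); last by move=> om /negbTE; rewrite /lo => ->.
apply: le_lower_integral => // om; rewrite /lo; case: ifPn => // w0.
by rewrite JE.
Qed.

Lemma mean_reset_at0 t : r 0 t = 0.
Proof.
have [_ _ _ _ reset_cont] := hstanding; have [reset0 _] := hA3.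
have [_ reset_at0] := reset_cont t.
rewrite /mean_reset_cost /expect.
under eq_integral do rewrite -{1}reset0 reset_at0.
by rewrite integral0.
Qed.

Lemma value_ge0 x t : (0 <= value pb w x t)%E.
Proof.
have /andP[g0 _] := hdiscount.
apply: le_ereal_inf_tmp => _ [a _ <-]; apply: integral_ge0 => om _.
apply: nneseries_ge0 => n _ _; rewrite lee_fin mulr_ge0 ?exprn_ge0//.
exact: step_cost_ge0.
Qed.

Lemma smooth_pieceI (I I' : set R) (M C : R) (F F' D : R -> R) : I `<=` I' ->
  (forall x, I x -> F' x = F x) -> (forall x, I x -> derive_in I' F x (D x)) ->
  (forall x, I x -> `|D x| <= M) ->
  (forall x y, I x -> I y -> `|D x - D y| <= C * `|x - y|) ->
  smooth_piece I M F'.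
Proof.
move=> II' FF' dF DM Dlip; exists D; split=> //.
  by move=> x Ix; apply: derive_in_sub (dF x Ix).
exists C; split; first exact: num_real.
move=> q Cq [x y] [/= Ix Iy]; apply: le_trans (Dlip _ _ Ix Iy) _.
by rewrite ler_wpM2r// ltW.
Qed.

Lemma piece_cases (sigma s Sigma : \bar R) x : 0 <= x <= cmax ->
  [\/ piece cmax 0 sigma x, piece cmax sigma s x, piece cmax s Sigma x
    | piece cmax Sigma +oo x].
Proof.
move=> xc; rewrite /piece /=; have /andP[x0 _] := xc.
have [h1|h1] := ltP x%:E sigma; first by apply: Or41; split=> //; rewrite lee_fin x0.
have [h2|h2] := ltP x%:E s; first by apply: Or42.
have [h3|h3] := ltP x%:E Sigma; first by apply: Or43.
by apply: Or44; split=> //; rewrite ltry.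
Qed.

Definition threshold_policy (phi : R) (S : nat -> R)
    (sigma s Sigma : nat -> \bar R) : policy := fun x t =>
  if (k <= t)%N then (true, phi)
  else if (x%:E < sigma t)%E then (true, phi)
  else if (x%:E < s t)%E then (false, S t - x)
  else if (x%:E < Sigma t)%E then (false, 0)
  else (true, phi).

Lemma threshold_policyE phi S (sigma s Sigma : nat -> \bar R) t x : (t < k)%N ->
  (sigma t <= s t)%E -> (s t <= Sigma t)%E ->
  let pi := threshold_policy phi S sigma s Sigma in
  [/\ piece cmax 0 (sigma t) x -> pi x t = (true, phi),
      piece cmax (sigma t) (s t) x -> pi x t = (false, S t - x),
      piece cmax (s t) (Sigma t) x -> pi x t = (false, 0)
    & piece cmax (Sigma t) +oo x -> pi x t = (true, phi)].
Proof.
move=> tk le1 le2; rewrite /threshold_policy leqNgt tk /=.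
split=> -[_ /andP[h1 h2]].
- by rewrite h2.
- by rewrite ltNge h1/= h2.
- by rewrite ltNge (le_trans le1 h1)/= ltNge h1/= h2.
- rewrite ltNge (le_trans le1 (le_trans le2 h1))/= ltNge (le_trans le2 h1)/=.
  by rewrite ltNge h1.
Qed.

Lemma threshold_policy_measurable phi S sigma s Sigma :
  measurable_fun setT
    (fun y : R * nat => threshold_policy phi S sigma s Sigma y.1 y.2).
Proof.
have m1 := @measurable_fst _ _ R nat.
have m2 := @measurable_snd _ _ R nat.
have mnat d' (Y : measurableType d') (q : nat -> Y) :
    measurable_fun [set: R * nat] (fun y : R * nat => q y.2).
  by apply: (measurableT_comp (f := q)) => // _ B _; rewrite setTI.
have mlt (q : nat -> \bar R) :
    measurable_fun [set: R * nat] (fun y : R * nat => (y.1%:E < q y.2)%E).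
  apply: (measurable_fun_bool true).
  by apply: measurable_lte => //; [exact/measurable_EFinP|exact: mnat].
have mphi : measurable_fun [set: R * nat] (fun=> (true, phi)) by exact: measurable_cst.
have morder : measurable_fun [set: R * nat] (fun y : R * nat => (false, S y.2 - y.1)).
  apply: measurable_fun_pair => //; apply: measurable_funB => //; exact: mnat.
have midle : measurable_fun [set: R * nat] (fun y : R * nat => (false, 0 : R)).
  exact: measurable_cst.
rewrite /threshold_policy.
apply: measurable_fun_ifT => //; first exact: (mnat _ _ (fun t => (k <= t)%N)).
apply: measurable_fun_ifT => //; apply: measurable_fun_ifT => //.
exact: measurable_fun_ifT.
Qed.

End ResetProblem.

(** * Optimality of thresholds *)

Theorem theorem1 (R : realType) (d : measure_display) (T : measurableType d)
  (P : probability T R) (w : nat -> {RV P >-> R}) (pb : problem R)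
  (cmax c K : R) (H : R -> nat -> R) (kappa m eta Lr : nat -> R)
  (f : R -> R) (L Pf : R)
  (hstanding : standing_assumptions pb)
  (hA1 : A1 pb)
  (hA2 : A2 pb w cmax c K H kappa m)
  (hA3 : A3 pb w eta Lr)
  (hA4 : A4 pb cmax)
  (hA5 : A5 w f L Pf)
  (hdiscount : 0 <= discount pb < 1)
  (hbound : forall t, (t < period pb)%N ->
     ((discount pb)%:E
        <= discount_bound (period pb) cmax c L Pf kappa m eta t)%E) :
  let J := value pb w in
  let J0 := J (reset_state pb) 0%N in
  let Es x t := expect w (fun v => (reset_cost pb x t v)%:E) in
  let EJ y t := expect w (fun v => J (Num.max (y - v) 0) t) in
  exists (phi : R) (S : nat -> R) (sigma s Sigma : nat -> \bar R),
  [/\ 0 <= phi <= cmax,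
      forall t, (t < period pb)%N ->
        0 <= S t <= cmax /\
        [/\ 0 <= sigma t, sigma t <= s t & s t <= Sigma t]%E,
      exists2 pi : policy, optimal_policy pb w `[0, cmax] pi &
        forall t, (t < period pb)%N -> forall x,
        [/\ piece cmax 0 (sigma t) x -> pi x t = (true, phi),
            piece cmax (sigma t) (s t) x -> pi x t = (false, S t - x),
            piece cmax (s t) (Sigma t) x -> pi x t = (false, 0)
          & piece cmax (Sigma t) +oo x -> pi x t = (true, phi)]
    & forall t, (t < period pb)%N ->
        [/\ forall x, 0 <= x <= cmax -> J x t \is a fin_num,
            forall x,
            [/\ piece cmax 0 (sigma t) x -> J x t = (J0 + Es x t)%E,
                piece cmax (sigma t) (s t) x ->
                  J x t = ((c * (S t - x) + K + H (S t) t)%:E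
                           + (discount pb)%:E * EJ (S t) t.+1)%E,
                piece cmax (s t) (Sigma t) x ->
                  J x t = ((H x t)%:E + (discount pb)%:E * EJ x t.+1)%E
              & piece cmax (Sigma t) +oo x -> J x t = (J0 + Es x t)%E]
          & let smooth a b :=
              smooth_piece (piece cmax a b)
                (slope_bound cmax c L Pf kappa m eta t)
                (fun x => fine (J x t)) in
            [/\ smooth 0%E (sigma t), smooth (sigma t) (s t),
                smooth (s t) (Sigma t) & smooth (Sigma t) +oo%E]]].
Proof.
set k := period pb; set g := discount pb => J J0 Es EJ.
pose mu := noise_law w; pose A := L * cmax + Pf; pose r := mean_reset_cost pb w.
have A0 : 0 < A := density_scale_gt0 hA4 hA5.
have [cmax0 _] := hA4; have [reset0 etaP] := hA3.
have [[c0 K0] kmP _ _] := hA2; have [k0 _ _ _ _] := hstanding.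
have [j [V [j0 Vreg Vk Vstage jE]]] :=
  reset_dynamic_program hstanding hA2 hA3 hA4 hA5 hdiscount hbound.
pose Phi t := stage_continuation mu g H t (V t.+1).
have kA t : (t < k)%N -> 0 <= kappa t + m t / A.
  by move=> /kmP[h1 h2]; rewrite addr_ge0// divr_ge0// ltW.
have zero_itv : (0 : R) <= 0 <= cmax by rewrite lexx.
have opt t x : (t < k)%N -> 0 <= x <= cmax ->
    exists u, optimal_order cmax c K (Phi t) x u.
  move=> tk xc; have [lip cvx _ _] := Vstage t tk.
  exact: (optimal_order_exists cmax0 c0 K0 (kA t tk) lip cvx xc).
(* Thresholds of all stages at once, with dummy values from stage [k] on. *)
have /choice[th thP] : forall t, exists th : R * \bar R * \bar R * \bar R,
    (t < k)%N -> [/\ 0 <= th.1.1.1 <= cmax,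
      [/\ 0 <= th.1.1.2, th.1.1.2 <= th.1.2 & th.1.2 <= th.2]%E
    & forall x,
      [/\ piece cmax 0 th.1.1.2 x -> j + r x t <= best_order_cost cmax c K (Phi t) x,
          piece cmax th.1.1.2 th.1.2 x ->
            [/\ best_order_cost cmax c K (Phi t) x <= j + r x t,
                optimal_order cmax c K (Phi t) x (th.1.1.1 - x) & x < th.1.1.1],
          piece cmax th.1.2 th.2 x ->
            best_order_cost cmax c K (Phi t) x <= j + r x t /\
            optimal_order cmax c K (Phi t) x 0
        & piece cmax th.2 +oo x -> j + r x t <= best_order_cost cmax c K (Phi t) x]].
  move=> t; have [tk|tk] := boolP (t < k)%N; last by exists (0, 0%E, 0%E, 0%E).
  have [lip cvx _ _] := Vstage t tk; have [[eta0 _] _ _ _ _] := etaP t (ltnW tk).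
  have [x y xc yc|x y x0 xy yc|x y p xc yc p01|S [sigma [s [Sigma h]]]] :=
    @reset_thresholds R cmax c K _ (Phi t) cmax0 c0 K0 (kA t tk) lip cvx
      (fun x => j + r x t) (eta t) eta0.
  - rewrite (_ : _ - _ = r x t - r y t); last by ring.
    exact: (mean_reset_lipschitz hA3 (ltnW tk) xc yc).
  - by rewrite lerD2l; exact: (mean_reset_nondecreasing hA3 (ltnW tk) x0 xy).
  - have := mean_reset_concave hA3 (ltnW tk) (andP xc).1 (andP yc).1 p01.
    rewrite -/r; lra.
  - by exists (S, sigma, s, Sigma).
pose S t := (th t).1.1.1; pose sigma t := (th t).1.1.2.
pose s t := (th t).1.2; pose Sigma t := (th t).2.
(* After a reset the stock is [0] and the clock is [0]: the same order [phi] is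
   optimal wherever the reset took place. *)
have [phi phi_opt] := opt 0%N 0 k0 zero_itv.
have [phi_c _] := phi_opt; rewrite subr0 in phi_c.
have jphi : j = order_cost c K (Phi 0%N) 0 phi.
  by rewrite {1}jE (best_order_costE phi_opt).
pose pi := threshold_policy pb phi S sigma s Sigma.
have piE t x : (t < k)%N ->
    [/\ piece cmax 0 (sigma t) x -> pi x t = (true, phi),
        piece cmax (sigma t) (s t) x -> pi x t = (false, S t - x),
        piece cmax (s t) (Sigma t) x -> pi x t = (false, 0)
      & piece cmax (Sigma t) +oo x -> pi x t = (true, phi)].
  by move=> tk; have [_ [_ h1 h2] _] := thP t tk; exact: threshold_policyE.
have VE t x : (t < k)%N -> 0 <= x <= cmax ->
    V t x = Num.min (j + r x t) (best_order_cost cmax c K (Phi t) x).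
  by move=> tk xc; have [_ _ _ ->] := Vstage t tk.
have V_le_reset t x : (t <= k)%N -> 0 <= x <= cmax -> V t x <= j + r x t.
  rewrite leq_eqVlt => /predU1P[->|tk] xc; first by rewrite Vk clamp_id.
  by rewrite VE// ge_min lexx.
have av := action_valueE hstanding hA1 hA2 hA3 hA4 hdiscount Vreg.
have av_reset t x u : (t <= k)%N -> 0 <= x <= cmax -> 0 <= u <= cmax ->
    action_value w pb (state_value pb V) (x, t) (true, u) =
    (r x t + order_cost c K (Phi 0%N) 0 u)%:E.
  move=> tk /andP[x0 _] uc; rewrite av//= ?reset0 ?subr0//.
  by rewrite mulr1.
have av_continue t x u : (t < k)%N -> 0 <= x <= cmax -> 0 <= u <= cmax - x ->
    action_value w pb (state_value pb V) (x, t) (false, u) =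
    (order_cost c K (Phi t) x u)%:E.
  move=> tk /andP[x0 _] uc; rewrite av//= ?(ltnW tk)//.
  by rewrite mulr0 add0r.
have [B VB] := state_value_bound hA4 Vreg.
have le_action z a : safe pb cmax z -> feasible pb cmax z a ->
    ((state_value pb V z)%:E <= action_value w pb (state_value pb V) z a)%E.
  case: z => x t; case: a => b u [/= xc tk] [/= tb].
  rewrite {1}/state_value /= tk; case: b tb => tb /= uc.
    rewrite reset0 subr0 in uc; rewrite av_reset// lee_fin.
    apply: le_trans (V_le_reset t x tk xc) _; rewrite addrC lerD2l {1}jphi.
    by have [_] := phi_opt; apply; rewrite subr0.
  have {}tk : (t < k)%N by rewrite ltn_neqAle tk andbT; apply/eqP => /tb.
  rewrite av_continue// lee_fin VE// ge_min; apply/orP; right.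
  have [u' uopt] := opt t x tk xc.
  by rewrite (best_order_costE uopt); apply: uopt.2.
have pi_action z : safe pb cmax z -> feasible pb cmax z (pi z.1 z.2) /\
    action_value w pb (state_value pb V) z (pi z.1 z.2) = (state_value pb V z)%:E.
  case: z => x t [/= xc]; rewrite leq_eqVlt => /predU1P[tk|tk].
    rewrite /pi /threshold_policy /= tk leqnn; split.
      by split=> //=; rewrite reset0 subr0.
    by rewrite av_reset// -jphi /state_value /= leqnn Vk clamp_id// addrC.
  rewrite /state_value /= (ltnW tk) VE//.
  have [_ _ /(_ x)[t1 t2 t3 t4]] := thP t tk.
  have [p1 p2 p3 p4] := piE t x tk.
  have [h|h|h|h] := piece_cases (sigma t) (s t) (Sigma t) xc.
  - rewrite p1//; split; first by split=> //=; rewrite reset0 subr0.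
    by rewrite av_reset ?(ltnW tk)// -jphi (min_idPl (t1 h)) addrC.
  - have [h1 h2 _] := t2 h; rewrite p2//; split.
      by split=> [/= tk'|]; [rewrite tk' ltnn in tk|exact: h2.1].
    by rewrite av_continue//; [rewrite (min_idPr h1) (best_order_costE h2)|exact: h2.1].
  - have [h1 h2] := t3 h; rewrite p3//; split.
      by split=> [/= tk'|]; [rewrite tk' ltnn in tk|exact: h2.1].
    by rewrite av_continue//; [rewrite (min_idPr h1) (best_order_costE h2)|exact: h2.1].
  - rewrite p4//; split; first by split=> //=; rewrite reset0 subr0.
    by rewrite av_reset ?(ltnW tk)// -jphi (min_idPl (t4 h)) addrC.
have [pi_opt valueE] := verification (noise_independent hA5) (noise_identical hA5)
  (noise_ge0 hA5) hstanding hA1 reset0 hA4 hdiscount VB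
  (state_value_measurable Vreg) (threshold_policy_measurable pb phi S sigma s Sigma)
  le_action pi_action.
have JE t x : (t <= k)%N -> 0 <= x <= cmax -> J x t = (V t x)%:E.
  by move=> tk xc; rewrite /J valueE// /state_value /= tk.
have J0E : J0 = j%:E.
  rewrite /J0 reset0 JE// VE// [r 0 0%N](mean_reset_at0 hstanding hA3) addr0 -jE.
  by rewrite minxx.
have EsE t x : (t <= k)%N -> 0 <= x -> Es x t = (r x t)%:E.
  exact: (expect_reset hA3).
have EJE t y : (t < k)%N -> 0 <= y <= cmax -> EJ y t.+1 = (mean mu (V t.+1) y)%:E.
  move=> tk yc; have [M M0 Mreg] := Vreg t.+1 tk.
  apply: (expect_value hA4 hA5 (J := fun x => J x t.+1) M0 Mreg) => // x; last exact: JE.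
  exact: value_ge0 hstanding hdiscount _ _.
exists phi, S, sigma, s, Sigma; split.
- by [].
- by move=> t /thP[h1 h2 _].
- by exists pi => // t tk x; exact: piE.
move=> t tk; have [_ [sigma_ge0 sigma_s s_Sigma] reg] := thP t tk.
(* The value function on each piece, with the expected value folded in [Phi]. *)
have Jform x :
  [/\ piece cmax 0 (sigma t) x -> J x t = (j + r x t)%:E,
      piece cmax (sigma t) (s t) x ->
        J x t = (- c * x + (c * S t + K + Phi t (S t)))%:E,
      piece cmax (s t) (Sigma t) x -> J x t = (Phi t x)%:E
    & piece cmax (Sigma t) +oo x -> J x t = (j + r x t)%:E].
  have [t1 t2 t3 t4] := reg x.
  split=> h; have [xc _] := h; rewrite (JE _ _ (ltnW tk) xc) (VE _ _ tk xc).
  - by rewrite (min_idPl (t1 h)).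
  - have [h1 h2 h3] := t2 h; rewrite (min_idPr h1) (best_order_costE h2).
    rewrite /order_cost -/(S t) subrKC subr_gt0 h3; congr (_%:E).
    by rewrite mulr1; ring.
  - have [h1 h2] := t3 h; rewrite (min_idPr h1) (best_order_costE h2).
    by rewrite /order_cost ltxx !mulr0 !add0r addr0.
  - by rewrite (min_idPl (t4 h)).
have Sc : 0 <= S t <= cmax by have [] := thP t tk.
have [[eta0 _] _ _ _ _] := etaP t (ltnW tk); have [kappa0 m0] := kmP t tk.
have mA0 : 0 <= m t / A by rewrite divr_ge0// ltW.
have [dR [dRP dRlip]] := mean_reset_derive hA3 (ltnW tk).
split.
- by move=> x xc; rewrite (JE _ _ (ltnW tk) xc).
- move=> x; have [f1 f2 f3 f4] := Jform x.
  split=> h; have [xc _] := h; have /andP[x0 _] := xc.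
  + by rewrite f1// J0E EsE// ltnW.
  + rewrite f2// EJE// -EFinM -EFinD; congr (_%:E).
    by rewrite /Phi /stage_continuation /continuation -/mu; ring.
  + by rewrite f3// EJE// -EFinM -EFinD.
  + by rewrite f4// J0E EsE// ltnW.
have reset_smooth a b : (forall x, piece cmax a b x -> J x t = (j + r x t)%:E) ->
    smooth_piece (piece cmax a b) (slope_bound cmax c L Pf kappa m eta t)
      (fun x => fine (J x t)).
  move=> Jr; apply: (@smooth_pieceI _ _ `[0, +oo[ _ (Lr t)
    (fun x => (0 * x + j) + r x t) _ (fun x => 0 + dR x)).
  - by move=> x [/andP[x0 _] _]; rewrite /= in_itv/= x0.
  - by move=> x xp; rewrite Jr//= mul0r add0r.
  - move=> x [/andP[x0 _] _]; apply: derive_inD; first exact: derive_in_affine.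
    exact: (dRP x x0).1.
  - move=> x [/andP[x0 _] _]; rewrite add0r; apply: le_trans (dRP x x0).2 _.
    by rewrite /slope_bound -/A; lra.
  - by move=> x y [/andP[x0 _] _] [/andP[y0 _] _]; rewrite !add0r; exact: dRlip.
split.
- by apply: reset_smooth => x; have [] := Jform x.
- apply: (@smooth_pieceI _ _ setT _ 0
    (fun x => - c * x + (c * S t + K + Phi t (S t))) _ (fun=> - c)) => //.
  + by move=> x xp; have [_ -> // _ _] := Jform x.
  + by move=> x _; exact: derive_in_affine.
  + by move=> x _; rewrite normrN ger0_norm// /slope_bound -/A; lra.
  + by move=> x y _ _; rewrite subrr normr0 mul0r.
- have [_ _ [D [DP DM [C C0 Dlip]]] _] := Vstage t tk.
  apply: (@smooth_pieceI _ _ `[0, cmax] _ C (Phi t) _ D).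
  + by move=> x [xc _]; rewrite /= in_itv.
  + by move=> x xp; have [_ _ -> //] := Jform x.
  + by move=> x [xc _]; exact: DP.
  + move=> x [xc _]; apply: le_trans (DM x xc) _; rewrite /slope_bound -/A; lra.
  + by move=> x y [xc _] [yc _]; exact: Dlip.
- by apply: reset_smooth => x; have [] := Jform x.
Qed.
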